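(* Let $P_1,\ldots,P_\ell\in\mathbb{Z}[n]$ with $P_i(0)=0$ and $\deg P_i=k$ for all $1\le i\le\ell$. For every $\varepsilon>0$ there exists $N_1=N_1(\varepsilon,P_1,\ldots,P_\ell)$ such that if $N\ge N_1$ and $A\subseteq[1,N]$, then there exists $n\in\mathbb{N}$ such that $$\frac{|A\cap(A+P_i(n))|}{N}>\left(\frac{|A|}{N}\right)^2-\varepsilon\qquad\text{for all }1\le i\le\ell.$$ Moreover, $N_1(\varepsilon,P_1,\ldots,P_\ell)$ may be taken to be a constant depending only on $P_1,\ldots,P_\ell$ times a tower of $2$'s of height $C^*_{k,\ell}+C\varepsilon^{-2}$, where $C$ is an absolute constant and $C^*_{k,\ell}$ depends only on $k$ and $\ell$.
   Context: $[1,N]=\{1,\ldots,N\}$ and $\mathbb{N}=\{1,2,3,\ldots\}$; $k\ge 1$. $A+s=\{a+s: a\in A\}$ (a subset of $\mathbb{Z}$). The tower function is defined by $T(1)=1$, $T(j+1)=2^{T(j)}$; a tower of $2$'s of height $h$ means $T(h)$, where a non-integer height $h$ is read as $\lceil h\rceil$. *)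

(* Defs.v *)
From HB Require Import structures.
From mathcomp Require Import all_boot all_order all_algebra.
From mathcomp Require Import finmap.
From mathcomp Require Import reals.

Set Implicit Arguments.
Unset Strict Implicit.
Unset Printing Implicit Defensive.

Import Order.TTheory GRing.Theory Num.Theory.

Local Open Scope ring_scope.

(* The value 0 at height 0 is a convention chosen so that the recursion gives
   T(1) = 2 ^ 0 = 1 and T(j+1) = 2 ^ T(j) for j >= 1. *)
Fixpoint tower (j : nat) : nat :=
  if j is j'.+1 then (2 ^ tower j')%N else 0%N.

(* For use with h > 0 only: the absolute value is a cast from int to nat. *)
Definition tower_real (R : realType) (h : R) : nat := tower `|Num.ceil h|%N.

Definition translate (A : {fset int}) (s : int) : {fset int} :=
  [fset (a + s)%R | a : int in A]%fset.

Definition subset_1N (N : nat) (A : {fset int}) : Prop :=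
  forall a : int, a \in A -> 1 <= a <= N%:Z.

Definition popular_difference (R : realType) (l : nat) (P : 'I_l -> {poly int})
    (eps : R) (N : nat) (A : {fset int}) (n : nat) : Prop :=
  forall i : 'I_l,
    #|` (A `&` translate A (P i).[n%:Z]%R)%fset |%:R / N%:R
      > (#|` A |%:R / N%:R) ^+ 2 - eps.

(* The assertion that N1 is an admissible value of N_1(eps, P_1, ..., P_l). *)
Definition admissible_threshold (R : realType) (l : nat)
    (P : 'I_l -> {poly int}) (eps : R) (N1 : nat) : Prop :=
  forall (N : nat) (A : {fset int}),
    (0 < N)%N -> (N1 <= N)%N -> subset_1N N A ->
    exists n : nat, (0 < n)%N /\ popular_difference P eps N A n.

(* The degree of a nonzero polynomial p is (size p).-1. *)
Definition poly_family (k l : nat) (P : 'I_l -> {poly int}) : Prop :=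
  forall i : 'I_l, (P i).[0] = 0 /\ size (P i) = k.+1.

(* Main.v *)
(** Embedding [1, N] in Z/NZ, the density of A ∩ (A + s) is, up to |s|/N, the Fourier
    series of the positive weights w_xi = |1_A^(xi)|^2, whose total mass is |A|/N and
    whose mass at xi = 0 is (|A|/N)^2. It therefore suffices to find a bounded n >= 1 with
    Re (sum_xi w_{i,xi} e(p_{i,xi}(n))) >= -eps for all i, where for each i the w_{i,xi}
    are positive weights of mass at most 1 and the p_{i,xi} are arbitrary real polynomials
    of degree at most k without constant term. Letting weights and phases depend on i is
    what removes all dependence on the coefficients of the P_i except through |P_i(n)| <= c n^k.

    Call two phases close if all coefficients of their difference are nearly rational with
    a fixed denominator D. Finitely many heavy clusters around a common phase are taken
    out greedily. The remaining phases have a small second moment on average over n at many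
    scales, since by van der Corput differencing an exponential sum that is large at k
    well separated scales has nearly rational coefficients. So if the clusters have mass
    less than eps/2 for each i, some n works. Otherwise a polynomial recurrence argument gives
    q such that every phase in a cluster is within 1/4 of an integer along the multiples q m,
    m <= H. Along these multiples the clusters contribute nonnegatively, so they can be
    discarded. This decreases the total mass, at most l, by eps/2, so there are at most
    2 l/eps steps. Each costs a bounded number of exponentials, and 2 B l/eps is at most
    (B l)^2 + eps^-2. *)

Require Import Defs.
From HB Require Import structures.
From mathcomp Require Import all_boot all_order all_algebra.
From mathcomp Require Import finmap.
From mathcomp Require Import reals.
From mathcomp Require Import boolp topology normedtype derive trigo.
From mathcomp Require Import complex.
From mathcomp Require Import zify ring lra.

Set Implicit Arguments.
Unset Strict Implicit.
Unset Printing Implicit Defensive.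

Import Order.TTheory GRing.Theory Num.Theory.
Import numFieldNormedType.Exports.

Local Open Scope ring_scope.

(** * Elementary bounds *)

Section ElementaryBounds.
Local Open Scope nat_scope.

Definition iexp (b x : nat) : nat := iter b (expn 2) x.

Lemma iexp_ge b x : x <= iexp b x.
Proof.
elim: b => [|b IH] //=; apply: leq_trans IH _.
exact/ltnW/ltn_expl.
Qed.

Lemma iexpD a b x : iexp (a + b) x = iexp a (iexp b x).
Proof. by rewrite /iexp iterD. Qed.

Lemma iexp_homo b x y : x <= y -> iexp b x <= iexp b y.
Proof. by move=> xy; elim: b => //= b IH; rewrite leq_exp2l. Qed.

Lemma iexp_leq a b x : a <= b -> iexp a x <= iexp b x.
Proof.
move=> ab; rewrite -(subnKC ab) iexpD; apply: iexp_homo; exact: iexp_ge.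
Qed.

(* Functions bounded by a fixed iterate of the exponential: the class of bounds
   through which every quantitative dependence is tracked. *)
Definition elem (f : nat -> nat) : Prop := exists b, forall x, f x <= iexp b x.

Lemma elem_le f g : (forall x, f x <= g x) -> elem g -> elem f.
Proof. by move=> fg [b hb]; exists b => x; apply: leq_trans (fg x) (hb x). Qed.

Lemma elem_id : elem id.
Proof. by exists 0. Qed.

Lemma elem_comp f g : elem f -> elem g -> elem (fun x => f (g x)).
Proof.
move=> [a ha] [b hb]; exists (a + b) => x; rewrite iexpD.
by apply: leq_trans (ha _) _; apply: iexp_homo.
Qed.

Lemma elem_const c : elem (fun=> c).
Proof.
exists c => x; apply: leq_trans (iexp_homo c (leq0n x)).
by elim: c => // c IH; apply: leq_ltn_trans IH _; apply: ltn_expl.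
Qed.

(** Two exponentials absorb a product because $x\le 2^x$ and $2x\le 2^x$; hence [elem] is closed
    under multiplication. *)
Lemma mul_leq_expexp x : x * x <= 2 ^ (2 ^ x).
Proof.
apply: (@leq_trans (2 ^ (x + x))).
  by rewrite expnD leq_mul // ltnW // ltn_expl.
rewrite leq_exp2l // addnn -mul2n.
by case: x => [|x]//; rewrite expnS leq_mul2l /= ltn_expl.
Qed.

Lemma elem_common f g : elem f -> elem g ->
  exists b, forall x, (f x <= iexp b x) && (g x <= iexp b x).
Proof.
move=> [a ha] [b hb]; exists (maxn a b) => x; apply/andP; split.
  by apply: leq_trans (ha x) _; apply: iexp_leq; rewrite leq_maxl.
by apply: leq_trans (hb x) _; apply: iexp_leq; rewrite leq_maxr.
Qed.

Lemma elem_mul f g : elem f -> elem g -> elem (fun x => f x * g x).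
Proof.
move=> ef eg; have [b hb] := elem_common ef eg; exists (2 + b) => x.
rewrite iexpD; apply: leq_trans (mul_leq_expexp _).
by case/andP: (hb x) => *; apply: leq_mul.
Qed.

Lemma elem_add f g : elem f -> elem g -> elem (fun x => f x + g x).
Proof.
move=> ef eg; have [b hb] := elem_common ef eg.
apply: (@elem_le _ (fun x => 2 * iexp b x)).
  by move=> x; case/andP: (hb x) => *; rewrite mul2n -addnn leq_add.
by apply: elem_mul; [exact: elem_const | exists b].
Qed.

Lemma elem_expn f g : elem f -> elem g -> elem (fun x => f x ^ g x).
Proof.
move=> ef eg; apply: (@elem_le _ (fun x => 2 ^ (f x * g x))).
  by move=> x; rewrite expnM; case: (g x) => // n; rewrite leq_exp2r // ltnW // ltn_expl.
by apply: (@elem_comp (expn 2)); [exists 1 | exact: elem_mul].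
Qed.

Lemma elem_fact f : elem f -> elem (fun x => (f x)`!).
Proof.
move=> ef; apply: (@elem_le _ (fun x => f x ^ f x)); last exact: elem_expn.
move=> x; elim: (f x) => // n IH; rewrite factS expnS leq_mul2l /=.
by apply: leq_trans IH _; case: n => // n; rewrite leq_exp2r.
Qed.

Lemma elem_maxn f g : elem f -> elem g -> elem (fun x => maxn (f x) (g x)).
Proof.
move=> ef eg; have [b hb] := elem_common ef eg; exists b => x.
by rewrite geq_max.
Qed.

Lemma elem_succ f : elem f -> elem (fun x => (f x).+1).
Proof.
move=> ef; apply: (@elem_le _ (fun x => f x + 1)); first by move=> x; rewrite addn1.
by apply: elem_add => //; exact: elem_const.
Qed.

End ElementaryBounds.

Create HintDb elem.
#[local] Hint Resolve elem_id elem_const elem_mul elem_add elem_expn elem_fact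
  elem_maxn elem_succ : elem.

(** * The circle *)

Section Circle.
Local Open Scope complex_scope.
Variable R : realType.
Implicit Types (x y t : R) (z : R[i]).

(** This is $\|x\|_{\mathbb R/\mathbb Z}\le t$. *)
Definition near_int x t : Prop := exists m : int, `|x - m%:~R| <= t.

Lemma near_int0 t : 0 <= t -> near_int 0 t.
Proof. by move=> t0; exists 0; rewrite subrr normr0. Qed.

Lemma near_int_le x t t' : t <= t' -> near_int x t -> near_int x t'.
Proof. by move=> tt [m hm]; exists m; apply: le_trans hm tt. Qed.

Lemma near_intD x y t t' : near_int x t -> near_int y t' -> near_int (x + y) (t + t').
Proof.
move=> [m hm] [n hn]; exists (m + n); rewrite intrD opprD addrACA.
by apply: le_trans (ler_normD _ _) _; apply: lerD.
Qed.

Lemma near_intZ (a : int) x t : near_int x t -> near_int (a%:~R * x) (`|a|%:~R * t).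
Proof.
move=> [m hm]; exists (a * m); rewrite intrM -mulrBr normrM.
by rewrite intr_norm ler_wpM2l.
Qed.

Lemma near_intMn (n : nat) x t : near_int x t -> near_int (n%:R * x) (n%:R * t).
Proof. by move/(near_intZ n%:Z); rewrite ger0_norm. Qed.

Lemma near_int_half x : near_int x 2^-1.
Proof.
exists (Num.floor (x + 2^-1)); have /andP[h1 h2] := floor_itv (x + 2^-1).
by rewrite ler_norml; apply/andP; split; move: h1 h2; rewrite intrD; lra.
Qed.

Lemma near_int_sum (I : Type) (s : seq I) (P : pred I) (F G : I -> R) :
  (forall i, P i -> near_int (F i) (G i)) ->
  near_int (\sum_(i <- s | P i) F i) (\sum_(i <- s | P i) G i).
Proof.
move=> h; elim: s => [|a s IH]; first by rewrite !big_nil; exact: near_int0.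
rewrite !big_cons; case: ifP => // Pa; exact: near_intD (h _ Pa) IH.
Qed.

(** The character $e(x)=e^{2\pi i x}$. *)
Definition expi x : R[i] := cos (x * (pi *+ 2)) +i* sin (x * (pi *+ 2)).

Lemma expiD x y : expi (x + y) = expi x * expi y.
Proof.
rewrite /expi mulrDl cosD sinD; apply/eqP; rewrite eq_complex /=.
by apply/andP; split; apply/eqP; ring.
Qed.

Lemma Re_expi x : complex.Re (expi x) = cos (x * (pi *+ 2)).
Proof. by []. Qed.

Lemma expi0 : expi 0 = 1.
Proof. by rewrite /expi mul0r cos0 sin0. Qed.

Lemma expi_nat (n : nat) : expi n%:R = 1.
Proof.
elim: n => [|n IH]; first exact: expi0.
by rewrite -addn1 natrD expiD IH mul1r /expi !mul1r cos2pi sin2pi.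
Qed.

Lemma expiNK x : expi x * expi (- x) = 1.
Proof. by rewrite -expiD subrr expi0. Qed.

Lemma expi_int (m : int) : expi m%:~R = 1.
Proof.
case: m => n; first exact: expi_nat.
have := expiNK n.+1%:R; rewrite expi_nat mul1r => <-.
by rewrite NegzE mulrNz.
Qed.

Lemma expiDint x (m : int) : expi (x + m%:~R) = expi x.
Proof. by rewrite expiD expi_int mulr1. Qed.

Lemma expiMn x (n : nat) : expi (n%:R * x) = expi x ^+ n.
Proof.
elim: n => [|n IH]; first by rewrite mul0r expi0.
by rewrite -natr1 mulrDl mul1r expiD IH exprSr.
Qed.

(** The modulus with values in [R]; the norm of [R[i]] takes its values in [R[i]]. *)
Definition cnorm z : R := ComplexField.Normc.normc z.

Lemma cnormE z : cnorm z = Num.sqrt (complex.Re z ^+ 2 + complex.Im z ^+ 2).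
Proof. by case: z. Qed.

Lemma cnorm_ge0 z : 0 <= cnorm z.
Proof. by rewrite cnormE sqrtr_ge0. Qed.

Lemma cnorm_sqr z : cnorm z ^+ 2 = complex.Re z ^+ 2 + complex.Im z ^+ 2.
Proof. by rewrite cnormE sqr_sqrtr // addr_ge0 // sqr_ge0. Qed.

Lemma cnormM z z' : cnorm (z * z') = cnorm z * cnorm z'.
Proof. exact: ComplexField.Normc.normcM. Qed.

Lemma cnormD z z' : cnorm (z + z') <= cnorm z + cnorm z'.
Proof. exact: le_normcD. Qed.

Lemma cnormN z : cnorm (- z) = cnorm z.
Proof. exact: normcN. Qed.

Lemma cnorm0 : cnorm 0 = 0.
Proof. exact: ComplexField.Normc.normc0. Qed.

Lemma cnorm1 : cnorm 1 = 1.
Proof. exact: ComplexField.Normc.normc1. Qed.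

Lemma cnormX z n : cnorm (z ^+ n) = cnorm z ^+ n.
Proof. by elim: n => [|n IH]; rewrite ?cnorm1 // !exprS cnormM IH. Qed.

Lemma cnorm_sum (I : Type) (s : seq I) (P : pred I) (F : I -> R[i]) :
  cnorm (\sum_(i <- s | P i) F i) <= \sum_(i <- s | P i) cnorm (F i).
Proof.
elim/big_ind2: _ => [|z x z' x' hz hz'|//]; first by rewrite cnorm0.
by apply: le_trans (cnormD _ _) _; apply: lerD.
Qed.

Lemma cnorm_expi x : cnorm (expi x) = 1.
Proof. by rewrite cnormE /= cos2Dsin2 sqrtr1. Qed.

Lemma cnorm_real x : cnorm x%:C = `|x|.
Proof. by rewrite cnormE /= expr0n /= addr0 sqrtr_sqr. Qed.

Lemma cnorm_nat (n : nat) : cnorm n%:R = n%:R.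
Proof. by rewrite -(rmorph_nat (real_complex R)) cnorm_real normr_nat. Qed.

Lemma Re_le_cnorm z : `|complex.Re z| <= cnorm z.
Proof.
rewrite -(@ler_pXn2r _ 2) ?nnegrE ?cnorm_ge0 // cnorm_sqr real_normK ?num_real //.
by rewrite lerDl sqr_ge0.
Qed.

Lemma cnorm_expiB x y : cnorm (expi x - expi y) = cnorm (expi (x - y) - 1).
Proof.
rewrite -[RHS]mulr1 -(cnorm_expi y) -cnormM mulrBl mul1r -expiD.
by rewrite subrK.
Qed.

Lemma norm_sin_le x : `|sin x| <= `|x|.
Proof.
wlog x0 : x / 0 <= x.
  move=> h; case: (leP 0 x) => [/h//|/ltW x0].
  by rewrite -normrN -sinN -(normrN x); apply: h; rewrite oppr_ge0.
have [c _] := MVT_segment x0 (fun y _ => is_derive_sin y)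
  (continuous_subspaceT (@continuous_sin R)).
rewrite sin0 !subr0 => ->.
by rewrite normrM ler_piMl // cos_max.
Qed.

(** The left side equals $2|\sin \pi x|$, and $\pi<4$. *)
Lemma cnorm_expiB1 x : cnorm (expi x - 1) <= 8 * `|x|.
Proof.
have -> : cnorm (expi x - 1) = 2 * `|sin (x * pi)|.
  apply/eqP; rewrite -(@eqrXn2 _ 2) ?cnorm_ge0 ?mulr_ge0 // cnorm_sqr.
  have -> : complex.Re (expi x - 1) = cos (x * (pi *+ 2)) - 1 by [].
  have -> : complex.Im (expi x - 1) = sin (x * (pi *+ 2)) - 0 by [].
  rewrite (mulrnAr x pi 2) cos_mulr2n sin_mulr2n [(2 * _) ^+ 2]exprMn real_normK ?num_real // subr0.
  have := cos2Dsin2 (x * pi); move: (cos _) (sin _) => c s cs.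
  have -> : s ^+ 2 = 1 - c ^+ 2 by rewrite -cs; ring.
  have -> : ((c * s) *+ 2) ^+ 2 = 4 * c ^+ 2 * s ^+ 2 by ring.
  have -> : s ^+ 2 = 1 - c ^+ 2 by rewrite -cs; ring.
  by apply/eqP; ring.
apply: (@le_trans _ _ (2 * `|x * pi|)); first by rewrite ler_pM2l // norm_sin_le.
rewrite normrM (ger0_norm (pi_ge0 R)).
have := pihalf_lt2 R; have := normr_ge0 x; nra.
Qed.

Lemma cnorm_expi_near x t : near_int x t -> cnorm (expi x - 1) <= 8 * t.
Proof.
move=> [m hm]; rewrite -[x](subrK m%:~R) (expiDint _ m).
by apply: le_trans (cnorm_expiB1 _) _; rewrite ler_pM2l.
Qed.

Lemma cnorm_expi_dist x y t : near_int (x - y) t -> cnorm (expi x - expi y) <= 8 * t.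
Proof. by move=> h; rewrite cnorm_expiB cnorm_expi_near. Qed.

Lemma Re_expi_ge0 x : near_int x 4^-1 -> 0 <= complex.Re (expi x).
Proof.
move=> [m]; rewrite -{2}[x](subrK m%:~R) expiDint Re_expi.
move: (x - _) => y hy; apply: cos_ge0_pihalf.
move: hy; rewrite ler_norml => /andP[h1 h2]; have := pi_gt0 R.
by rewrite -mulr_natr; nra.
Qed.

Lemma Re_expi_le0 x : 4^-1 <= x <= 2^-1 -> complex.Re (expi x) <= 0.
Proof.
move=> /andP[h1 h2]; rewrite Re_expi; have pi0 := pi_gt0 R.
rewrite -cos_pihalf; have := @ltr_cos R.
move=> /(_ (x * (pi *+ 2)) (pi / 2)).
rewrite !in_itv /= -(mulr_natr pi 2); move: (pi : R) pi0 => q q0 h.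
by rewrite leNgt h -?leNgt ?subr_ge0; [nra | apply/andP; split; nra | apply/andP; split; nra].
Qed.

Lemma cnorm_expiX_le z n : cnorm z = 1 -> cnorm (z ^+ n - 1) <= n%:R * cnorm (z - 1).
Proof.
move=> z1; rewrite subrX1 cnormM mulrC ler_wpM2r ?cnorm_ge0 //.
apply: le_trans (cnorm_sum _ _ _) _.
rewrite (eq_bigr (fun=> 1)) ?sumr_const ?card_ord // => i _.
by rewrite cnormX z1 expr1n.
Qed.

(* For [0 < t <= 1/2] some multiple [m t] lies in [1/4, 1/2], where [expi] has
   distance at least 1 from 1. *)
Lemma near_int_cnorm x : near_int x (cnorm (expi x - 1)).
Proof.
have pos t : 0 < t <= 2^-1 -> t <= cnorm (expi t - 1).
  move=> /andP[t0 t2].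
  have [m /andP[m1 m2]] : exists m : nat, 4^-1 <= m%:R * t <= 2^-1.
    have u1 : 1 <= 2^-1 / t by rewrite ler_pdivlMr ?mul1r.
    have u0 : 0 <= 2^-1 / t by apply: le_trans u1.
    (* The multiple is $N=\lfloor 1/(2t)\rfloor\ge 1$; then $1/(2t)<N+1\le 2N$ gives $Nt\ge 1/4$. *)
    have [N /andP[au ua]] : exists N : nat, N%:R <= 2^-1 / t < N.+1%:R.
      by exists (Num.truncn (2^-1 / t)); exact: truncn_itv.
    have ut : 2^-1 / t * t = 2^-1 by rewrite divfK ?gt_eqF.
    have a1 : 1 <= N%:R :> R.
      by have := le_lt_trans u1 ua; rewrite ltr1n ler1n.
    exists N; move: au ua a1 ut; rewrite -(natr1 N).
    move: N%:R (_ / t) => a u au ua a1 ut.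
    have p1 : 0 <= (u - a) * t by rewrite mulr_ge0 ?subr_ge0 // ltW.
    have p2 : 0 <= (2 * a - u) * t by rewrite mulr_ge0 ?(ltW t0) //; lra.
    by apply/andP; split; lra.
  have h := @Re_expi_le0 (m%:R * t); rewrite m1 m2 in h; move/(_ isT) in h.
  have h1 : 1 <= cnorm (expi (m%:R * t) - 1).
    apply: le_trans (Re_le_cnorm _); rewrite ler_normr; apply/orP; right.
    by move: h => /=; lra.
  have := le_trans h1 _; rewrite expiMn => /(_ _ (cnorm_expiX_le _ (cnorm_expi _))).
  by have := cnorm_ge0 (expi t - 1); move: (cnorm _) (_%:R) m1 m2 => c a; nra.
have [m hm] := near_int_half x; exists m.
move: hm; rewrite -{3}[x](subrK m%:~R) expiDint; move: (x - _) => y hy.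
have [y0|y0|->] := ltgtP y 0; last by rewrite normr0 cnorm_ge0.
  rewrite ltr0_norm // in hy *.
  have -> : cnorm (expi y - 1) = cnorm (expi (- y) - 1).
    rewrite -[LHS]mul1r -(cnorm_expi (- y)) -cnormM mulrBr mulr1 mulrC expiNK.
    by rewrite -cnormN opprB.
  by apply: pos; rewrite oppr_gt0 y0.
by rewrite gtr0_norm // in hy *; apply: pos; rewrite y0.
Qed.

End Circle.

(** * Exponential sums *)

Section ExpSum.
Local Open Scope complex_scope.
Variable R : realType.
Implicit Types (x y t : R) (f : nat -> R).

Definition esum (M : nat) f : R[i] := \sum_(n < M) expi (f n).

Lemma esumS M f : esum M.+1 f = esum M f + expi (f M).
Proof. exact: big_ord_recr. Qed.

Lemma conjcM (z z' : R[i]) : conjc (z * z') = conjc z * conjc z'.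
Proof. exact: rmorphM. Qed.

Lemma conjc_sum (I : Type) (s : seq I) (P : pred I) (F : I -> R[i]) :
  conjc (\sum_(i <- s | P i) F i) = \sum_(i <- s | P i) conjc (F i).
Proof. exact: rmorph_sum. Qed.

Lemma conjc_expi x : conjc (expi x) = expi (- x).
Proof.
by rewrite /expi /= mulNr trigo.cosN trigo.sinN.
Qed.

Lemma cnorm_conj (z : R[i]) : cnorm (conjc z) = cnorm z.
Proof. by case: z => a b; rewrite !cnormE /= sqrrN. Qed.

Lemma cnorm_esumN M f : cnorm (esum M (fun n => - f n)) = cnorm (esum M f).
Proof.
rewrite -[RHS]cnorm_conj conjc_sum; congr cnorm; apply: eq_bigr => n _.
exact: esym (conjc_expi _).
Qed.

Lemma cnorm_esum_le M f : cnorm (esum M f) <= M%:R.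
Proof.
apply: le_trans (cnorm_sum _ _ _) _.
by rewrite (eq_bigr (fun=> 1)) ?sumr_const ?card_ord // => i _; rewrite cnorm_expi.
Qed.

(** A shift by one telescopes: it trades one end term for another, at cost at most 2. *)
Lemma cnorm_esum_shift M f h :
  cnorm (esum M (fun n => f (n + h)%N) - esum M f) <= 2 * h%:R.
Proof.
elim: h => [|h IH].
  rewrite mulr0 (_ : esum _ _ = esum M f) ?subrr ?cnorm0 //.
  by apply: eq_bigr => n _; rewrite addn0.
have step : esum M (fun n => f (n + h.+1)%N) - esum M (fun n => f (n + h)%N)
    = expi (f (M + h)%N) - expi (f h).
  elim: M {IH} => [|M IH]; first by rewrite /esum !big_ord0 add0n !subrr.
  move/eqP: IH; rewrite subr_eq => /eqP IH.
  by rewrite !esumS IH addnS addSn; ring.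
rewrite -[X in X - _](subrK (esum M (fun n => f (n + h)%N))) -addrA step.
rewrite -(natr1 h) mulrDr mulr1 addrC; apply: le_trans (cnormD _ _) _; apply: lerD => //.
by apply: le_trans (cnormD _ _) _; rewrite cnormN !cnorm_expi.
Qed.

Lemma sqr_sum_le (M : nat) (a : nat -> R) :
  (\sum_(n < M) a n) ^+ 2 <= M%:R * \sum_(n < M) a n ^+ 2.
Proof.
case: M => [|M]; first by rewrite !big_ord0 expr0n mul0r.
set s := \sum_(n < _) a n; set q := \sum_(n < _) _; set m : R := M.+1%:R.
have m0 : 0 < m by rewrite ltr0n.
have : 0 <= \sum_(n < M.+1) (m * a n - s) ^+ 2 by apply: sumr_ge0 => n _; exact: sqr_ge0.
have -> : \sum_(n < M.+1) (m * a n - s) ^+ 2 = m * (m * q - s ^+ 2).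
  rewrite (eq_bigr (fun n : 'I_M.+1 => m ^+ 2 * a n ^+ 2 - (2 * m * s) * a n + s ^+ 2)); last first.
    by move=> n _; ring.
  rewrite big_split /= sumrB -!mulr_sumr -/q -/s sumr_const card_ord.
  by rewrite -mulr_natl -/m; ring.
by rewrite pmulr_rge0 // subr_ge0.
Qed.

Lemma cnorm_sqr_conj (z : R[i]) : (cnorm z ^+ 2)%:C = z * conjc z.
Proof.
rewrite cnorm_sqr; case: z => a b /=.
by apply/eqP; rewrite eq_complex /=; apply/andP; split; apply/eqP; ring.
Qed.

Lemma second_moment (I : finType) (w : I -> R) (phi : I -> nat -> R) M :
  (forall i, 0 <= w i) ->
  \sum_(n < M) cnorm (\sum_i (w i)%:C * expi (phi i n)) ^+ 2 <=
  \sum_i \sum_j w i * w j * cnorm (esum M (fun n => phi i n - phi j n)).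
Proof.
move=> w0; apply: le_trans (ler_norm _) _; rewrite -cnorm_real rmorph_sum /=.
have -> : \sum_(n < M) (cnorm (\sum_i (w i)%:C * expi (phi i n)) ^+ 2)%:C =
    \sum_i \sum_j (w i * w j)%:C * esum M (fun n => phi i n - phi j n).
  rewrite [RHS](eq_bigr (fun i => \sum_j \sum_(n < M)
    ((w i)%:C * expi (phi i n)) * ((w j)%:C * expi (- phi j n)))); last first.
    move=> i _; apply: eq_bigr => j _; rewrite mulr_sumr; apply: eq_bigr => n _.
    by rewrite expiD rmorphM mulrACA.
  rewrite [RHS](eq_bigr (fun i => \sum_(n < M) \sum_j
    ((w i)%:C * expi (phi i n)) * ((w j)%:C * expi (- phi j n)))); last first.
    by move=> i _; rewrite exchange_big.
  rewrite exchange_big; apply: eq_bigr => n _; rewrite cnorm_sqr_conj mulr_suml.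
  apply: eq_bigr => i _; rewrite conjc_sum mulr_sumr; apply: eq_bigr => j _.
  by rewrite conjcM conjc_expi conjc_real.
apply: le_trans (cnorm_sum _ _ _) _; apply: ler_sum => i _.
apply: le_trans (cnorm_sum _ _ _) _; apply: ler_sum => j _.
by rewrite cnormM cnorm_real ger0_norm // mulr_ge0.
Qed.

(** Averaging over the shifts $h<H$ and applying Cauchy-Schwarz bounds $(HM)^2$ by $4x^2M$ times the
    sum of the correlations of all pairs of shifts. If the conclusion failed, the diagonal would
    give at most a quarter of $(HM)^2$, because $H\ge16x^2$, and the other pairs at most half. *)
Lemma van_der_corput (x H M : nat) f :
  (0 < x)%N -> (16 * x ^ 2 <= H)%N -> (4 * x * H <= M)%N ->
  M%:R <= x%:R * cnorm (esum M f) ->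
  exists h h', [/\ (h < H)%N, (h' < h)%N &
    M%:R <= (8 * x ^ 2)%:R * cnorm (esum M (fun n => f (n + h)%N - f (n + h')%N))].
Proof.
move=> x0 xH HM big; apply: contrapT => no.
pose g h h' n := f (n + h)%N - f (n + h')%N.
have gC h h' : cnorm (esum M (g h h')) = cnorm (esum M (g h' h)).
  rewrite -cnorm_esumN; congr cnorm.
  by apply: eq_bigr => n _; rewrite opprB.
have small h h' : (h < H)%N -> (h' < H)%N -> h != h' ->
    (8 * x ^ 2)%:R * cnorm (esum M (g h h')) <= M%:R.
  move=> hH hH'; rewrite neq_ltn => /orP[lt|lt]; rewrite leNgt; apply/negP => lt'.
    apply: no; exists h', h; split => //; apply/ltW.
    by rewrite -/(g h' h) gC.
  by apply: no; exists h, h'; split => //; apply: ltW.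
set s := cnorm (esum M f) in big.
(* The factor 1 gives [T] the shape of [second_moment], with the shifts as frequencies of weight
   1. *)
pose T n : R[i] := \sum_(h < H) (1)%:C * expi (f (n + h)%N).
pose U : R := \sum_(n < M) cnorm (T n).
have xR : 1 <= x%:R :> R by rewrite ler1n.
have HR : 16 * x%:R ^+ 2 <= H%:R :> R by rewrite -natrX -natrM ler_nat.
have MR : 4 * x%:R * H%:R <= M%:R :> R by rewrite -!natrM ler_nat.
have lower : H%:R * s <= U + 2 * H%:R ^+ 2.
  have TE : \sum_(n < M) T n = \sum_(h < H) esum M (fun n => f (n + h)%N).
    rewrite exchange_big; apply: eq_bigr => h _; apply: eq_bigr => n _.
    by rewrite mul1r.
  have -> : H%:R * s = cnorm (\sum_(n < M) T n -
      \sum_(h < H) (esum M (fun n => f (n + h)%N) - esum M f)).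
    rewrite TE sumrB opprB addrC subrK sumr_const card_ord -(mulr_natl (esum M f)).
    by rewrite cnormM cnorm_nat.
  apply: le_trans (cnormD _ _) _; rewrite cnormN; apply: lerD.
    exact: cnorm_sum.
  apply: le_trans (cnorm_sum _ _ _) _.
  apply: (@le_trans _ _ (\sum_(h < H) 2 * H%:R)).
    apply: ler_sum => h _; apply: le_trans (cnorm_esum_shift _ _ _) _.
    by rewrite ler_pM2l // ler_nat ltnW.
  by rewrite sumr_const card_ord -(mulr_natl (2 * _)); rewrite le_eqVlt; apply/orP; left; apply/eqP; ring.
have upper : U ^+ 2 <= M%:R * \sum_(h < H) \sum_(h' < H) cnorm (esum M (g h h')).
  apply: le_trans (sqr_sum_le M (fun n => cnorm (T n))) _; rewrite ler_wpM2l //.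
  have sm := @second_moment 'I_H (fun=> 1) (fun (h : 'I_H) n => f (n + h)%N) M (fun=> ler01).
  apply: le_trans sm _.
  by apply: ler_sum => h _; apply: ler_sum => h' _; rewrite !mul1r.
have offdiag : \sum_(h < H) \sum_(h' < H) cnorm (esum M (g h h')) <=
    H%:R * M%:R + H%:R ^+ 2 * (M%:R / (8 * x%:R ^+ 2)).
  apply: (@le_trans _ _ (\sum_(h < H) (M%:R + H%:R * (M%:R / (8 * x%:R ^+ 2))))).
    apply: ler_sum => h _; rewrite (bigD1 h) //=; apply: lerD.
      exact: cnorm_esum_le.
    apply: (@le_trans _ _ (\sum_(h' < H) (M%:R / (8 * x%:R ^+ 2)))); last first.
      by rewrite sumr_const card_ord -(mulr_natl (_ / _)).
    rewrite [leRHS](bigD1 h) //= -[leLHS]add0r; apply: lerD.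
      by rewrite divr_ge0 // mulr_ge0 // exprn_ge0.
    apply: ler_sum => h' neq; rewrite ler_pdivlMr ?mulr_gt0 ?exprn_gt0 ?ltr0n //.
    rewrite mulrC; have := small h h' (ltn_ord h) (ltn_ord h').
    by rewrite natrM natrX eq_sym => /(_ neq).
  by rewrite sumr_const card_ord -(mulr_natl (_ + _)); rewrite le_eqVlt; apply/orP; left; apply/eqP; ring.
have := le_trans upper (ler_wpM2l _ offdiag) => /(_ (ler0n _ _)).
have x2 : 0 < x%:R ^+ 2 :> R by rewrite exprn_gt0 ?ltr0n.
have H0 : 0 < H%:R :> R by apply: lt_le_trans HR; rewrite mulr_gt0.
have M0 : 0 < M%:R :> R by apply: lt_le_trans MR; rewrite !mulr_gt0 // ltr0n.
move=> up.
(* The boundary error $2xH^2$ of the shifts is at most $HM/2$, because $M\ge 4xH$. *)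
have low2 : H%:R * M%:R <= 2 * x%:R * U.
  have a1 : x%:R * (H%:R * s) <= x%:R * (U + 2 * H%:R ^+ 2) by rewrite ler_wpM2l.
  have a2 : H%:R * M%:R <= H%:R * (x%:R * s) by rewrite ler_wpM2l // ltW.
  have a3 : H%:R * (4 * x%:R * H%:R) <= H%:R * M%:R :> R by rewrite ler_wpM2l.

  move: a1 a2 a3; lra.
have low3 : (H%:R * M%:R) ^+ 2 <= 4 * x%:R ^+ 2 * U ^+ 2.
  have -> : 4 * x%:R ^+ 2 * U ^+ 2 = (2 * x%:R * U) ^+ 2 by ring.
  by rewrite ler_sqr ?nnegrE // ?mulr_ge0 // ?sumr_ge0 // => *; apply: cnorm_ge0.
have up2 : 4 * x%:R ^+ 2 * U ^+ 2 <= 4 * x%:R ^+ 2 * (M%:R * (H%:R * M%:R + H%:R ^+ 2 * (M%:R / (8 * x%:R ^+ 2)))).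
  by rewrite ler_wpM2l // mulr_ge0 // ltW.
have e : 4 * x%:R ^+ 2 * (M%:R * (H%:R * M%:R + H%:R ^+ 2 * (M%:R / (8 * x%:R ^+ 2))))
   = 4 * x%:R ^+ 2 * H%:R * M%:R ^+ 2 + (H%:R * M%:R) ^+ 2 / 2 :> R.
  by field; rewrite gt_eqF // (lt_le_trans _ xR).
have hm : 16 * x%:R ^+ 2 * (H%:R * M%:R ^+ 2) <= H%:R * (H%:R * M%:R ^+ 2) :> R.
  by rewrite ler_wpM2r // mulr_ge0 // sqr_ge0.
have p0 : 0 < (H%:R * M%:R) ^+ 2 :> R by rewrite exprn_gt0 // mulr_gt0.
by rewrite e in up2; move: low3 up2 hm p0; lra.
Qed.

End ExpSum.

(** * Inverse theorem for exponential sums *)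

Section AffineComp.
Variable F : comNzRingType.
Implicit Types (p : {poly F}) (a h : F) (m : nat).

Lemma size_mulX_addC p c m : (size (p * 'X + c%:P)%R <= m.+1)%N -> (size p <= m)%N.
Proof. by rewrite size_MXaddC; case: ifP => [/andP[/eqP-> _]|_ //]; rewrite size_poly0. Qed.

Lemma coef_affine_mul p a h m :
  (p * (a *: 'X + h%:P))`_m.+1 = a * p`_m + h * p`_m.+1.
Proof. by rewrite mulrDr -scalerAr !coefE /= mulrC [X in _ + X]mulrC [X in X + _]mulrC. Qed.

Lemma size_comp_affine p a h m : (size p <= m)%N ->
  (size (p \Po (a *: 'X + h%:P))%R <= m)%N.
Proof.
elim/poly_ind: p m => [|p c IH] [|m].
- by rewrite comp_poly0 size_poly0.
- by rewrite comp_poly0 size_poly0.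
- by rewrite leqn0 size_poly_eq0 => /eqP ->; rewrite comp_poly0 size_poly0.
move=> /size_mulX_addC /IH /leq_sizeP sp; apply/leq_sizeP => -[//|j]; rewrite ltnS => mj.
rewrite comp_poly_MXaddC coefD coef_affine_mul coefC /= addr0.
by rewrite !sp ?mulr0 ?addr0 // leqW.
Qed.

Lemma coef_comp_affine_lead p a h m : (size p <= m.+1)%N ->
  (p \Po (a *: 'X + h%:P))`_m = a ^+ m * p`_m.
Proof.
elim/poly_ind: p m => [|p c IH] m; first by rewrite comp_poly0 !coef0 mulr0.
move=> /size_mulX_addC sp; rewrite comp_poly_MXaddC !coefD coefMX !coefC.
case: m sp => [|m] sp /=.
  by move: sp; rewrite leqn0 size_poly_eq0 => /eqP->; rewrite comp_poly0 mul0r coef0 expr0 mul1r.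
rewrite coef_affine_mul !addr0 IH // (leq_sizeP _ _ (size_comp_affine _ _ sp)) //.
by rewrite mulr0 addr0 exprS mulrA.
Qed.

(** In the difference of two shifts the term $p_m$ cancels, which leaves a multiple of the leading
    coefficient $p_{m+1}$; this is what differencing retains. *)
Lemma coef_comp_shift p h m : (size p <= m.+2)%N ->
  (p \Po (1 *: 'X + h%:P))`_m = p`_m + m.+1%:R * h * p`_m.+1.
Proof.
elim/poly_ind: p m => [|p c IH] m; first by rewrite comp_poly0 !coef0 mulr0 addr0.
move=> /size_mulX_addC sp; rewrite comp_poly_MXaddC !coefD !coefMX !coefC /= addr0.
case: m sp => [|m] sp /=.
  have -> : p = (p`_0)%:P by apply: size1_polyC.
  by rewrite comp_polyC !coefE /=; ring.
rewrite coef_affine_mul !addr0 IH // (coef_comp_affine_lead _ _ sp).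
by rewrite expr1n -(natr1 m.+1); ring.
Qed.

End AffineComp.

(** * The leading coefficient, by differencing *)

Section LeadingCoefficient.
Variable R : realType.
Implicit Types (p : {poly R}).

(** Induction on the degree: linear phases give a geometric sum, and differencing passes from $p$ to
    a polynomial of smaller degree whose leading coefficient is an integer multiple of that of
    $p$. *)
Lemma near_int_lead (k : nat) : exists D W : nat -> nat, elem D /\ elem W /\
  forall x, (0 < x)%N -> (0 < D x)%N /\
  forall M p, (size p <= k.+2)%N -> (0 < M)%N ->
    M%:R <= x%:R * cnorm (esum M (fun n => p.[n%:R])) ->
    near_int ((D x)%:R * p`_k.+1) ((W x)%:R / M%:R).
Proof.
elim: k => [|k [D [W [eD [eW IH]]]]].
  exists (fun=> 1%N), (fun x => 2 * x)%N.
  split; first by auto with elem.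
  split; first by auto with elem.
  move=> x x0; split => // M p sp M0 big.
  pose a := p`_0; pose b := p`_1.
  have pE n : p.[n%:R] = a + n%:R * b.
    rewrite (horner_coef_wide _ sp) !big_ord_recr big_ord0 /=.
    by rewrite add0r expr0 expr1 mulr1 mulrC.
  rewrite mul1r; apply: near_int_le (near_int_cnorm _).
  have S0 : cnorm (esum M (fun n => p.[n%:R])) * cnorm (expi b - 1) <= 2.
    have -> : esum M (fun n => p.[n%:R]) = expi a * \sum_(n < M) expi b ^+ n.
      by rewrite mulr_sumr; apply: eq_bigr => n _; rewrite pE expiD expiMn.
    rewrite cnormM cnorm_expi mul1r -cnormM mulrC -subrX1 -expiMn.
    by apply: le_trans (cnormD _ _) _; rewrite cnormN cnorm1 cnorm_expi.
  have M0' : 0 < M%:R :> R by rewrite ltr0n.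
  rewrite ler_pdivlMr // natrM.
  have c0 := cnorm_ge0 (expi b - 1).
  have := ler_wpM2r c0 big; have := ler_wpM2l (ler0n R x) S0; lra.
pose H x := (16 * x ^ 2)%N.
exists (fun x => D (8 * x ^ 2) * k.+2 * (H x)`!)%N.
exists (fun x => (H x)`! * W (8 * x ^ 2) + 4 * x * H x)%N.
have e1 := elem_comp eD; have e2 := elem_comp eW.
split; first by rewrite /H; auto 10 with elem.
split; first by rewrite /H; auto 10 with elem.
move=> x x0; have x2 : (0 < 8 * x ^ 2)%N by rewrite muln_gt0 expn_gt0 x0.
have [D0 {}IH] := IH _ x2; split; first by rewrite !muln_gt0 D0 fact_gt0.
move=> M p sp M0 big; have M0' : 0 < M%:R :> R by rewrite ltr0n.
(* For $M<4xH$ the allowed error exceeds $1/2$, so there is nothing to prove. *)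
case: (leqP (4 * x * H x) M) => HM; last first.
  apply: near_int_le (near_int_half _).
  rewrite ler_pdivlMr //; apply: (@le_trans _ _ M%:R); first by rewrite ler_piMl //; lra.
  by rewrite ler_nat; lia.
have [h [h' [hH hh' {}big]]] := van_der_corput x0 (leqnn _) HM big.
pose g := (p \Po (1 *: 'X + h%:R%:P)) - (p \Po (1 *: 'X + h'%:R%:P)).
have gE n : g.[n%:R] = p.[(n + h)%:R] - p.[(n + h')%:R].
  by rewrite hornerD hornerN !horner_comp !hornerE !natrD.
have glead : g`_k.+1 = k.+2%:R * (h - h')%:R * p`_k.+2.
  by rewrite coefB !coef_comp_shift // (natrB _ (ltnW hh')); ring.
have sg : (size g <= k.+2)%N.
  apply/leq_sizeP => j; rewrite leq_eqVlt coefB => /orP[/eqP<-|kj].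
    by rewrite !(coef_comp_affine_lead _ _ sp) subrr.
  by rewrite !(leq_sizeP _ _ (size_comp_affine _ _ sp)) // subrr.
have {}IH := IH M g sg M0.
have /IH {IH} : M%:R <= (8 * x ^ 2)%:R * cnorm (esum M (fun n => g.[n%:R])).
  apply: le_trans big _; rewrite ler_wpM2l //; rewrite le_eqVlt; apply/orP; left; apply/eqP.
  by congr cnorm; apply: eq_bigr => n _; rewrite gE.
(* The shifts depend on $p$, but the factorial is divisible by every possible $h-h'$; this makes the
   denominator depend on $x$ only. *)
rewrite glead; have dv : (h - h' %| (H x)`!)%N.
  by apply: dvdn_fact; rewrite subn_gt0 hh' /=; exact: leq_trans (leq_subr _ _) (ltnW hH).
case/dvdnP: dv => c cE hn; have := near_intMn c hn.
rewrite cE !natrM => h1.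
have -> : (D (8 * x ^ 2)%N)%:R * k.+2%:R * (c%:R * (h - h')%:R) * p`_k.+2 =
  c%:R * ((D (8 * x ^ 2)%N)%:R * (k.+2%:R * (h - h')%:R * p`_k.+2)) by ring.
apply: near_int_le h1; rewrite mulrA ler_wpM2r ?invr_ge0 // -natrM ler_nat.
apply: leq_trans (leq_addr _ _); rewrite leq_mul2r.
by apply/orP; right; rewrite leq_pmulr // subn_gt0.
Qed.

End LeadingCoefficient.

(** Coefficients known up to about $1/b$ change a phase of degree at most $k$ on $[0,a]$ by about
    $a^k/b$; consecutive scales must be separated enough to make this small. *)
Definition growth (k W : nat) : rel nat := fun a b => (W * a ^ k <= b)%N.

(** * All coefficients, from several scales *)

Section AllCoefficients.
Variable R : realType.
Implicit Types (p : {poly R}).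

Lemma esum_blocks M D (f : nat -> R) :
  esum (M * D) f = \sum_(r < D) esum M (fun t => f (t * D + r)%N).
Proof.
rewrite exchange_big; elim: M => [|M IH]; first by rewrite mul0n /esum !big_ord0.
rewrite big_ord_recr -IH mulSnr /esum big_split_ord /=.
by congr (_ + _); apply: eq_bigr => r _.
Qed.

Lemma cnorm_esum_addn a b (f : nat -> R) :
  cnorm (esum (a + b) f) <= cnorm (esum a f) + b%:R.
Proof.
rewrite /esum big_split_ord /=; apply: le_trans (cnormD _ _) _; rewrite lerD2l.
exact: (cnorm_esum_le b (fun i => f (a + i)%N)).
Qed.

(** Pigeonhole over the residues mod $D$; the incomplete last block costs at most $D\le M/(2x)$. *)
Lemma esum_residue x D M (f : nat -> R) : (0 < x)%N -> (0 < D)%N -> (2 * x * D <= M)%N ->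
  M%:R <= x%:R * cnorm (esum M f) ->
  exists2 r, (r < D)%N &
    (M %/ D)%:R <= 2 * x%:R * cnorm (esum (M %/ D) (fun t => f (t * D + r)%N)).
Proof.
move=> x0 D0 xDM big; apply: contrapT => no.
set M' := (M %/ D)%N in no *.
have small r : (r < D)%N ->
    2 * x%:R * cnorm (esum M' (fun t => f (t * D + r)%N)) < M'%:R.
  by move=> rD; rewrite ltNge; apply/negP => h; apply: no; exists r.
have s1 : cnorm (esum M f) <=
    \sum_(r < D) cnorm (esum M' (fun t => f (t * D + r)%N)) + D%:R.
  rewrite {1}(divn_eq M D); apply: le_trans (cnorm_esum_addn _ _ _) _.
  apply: lerD; last by rewrite ler_nat ltnW // ltn_mod.
  by rewrite esum_blocks; exact: cnorm_sum.
have s2 : 2 * x%:R * \sum_(r < D) cnorm (esum M' (fun t => f (t * D + r)%N)) < D%:R * M'%:R.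
  rewrite mulr_sumr; have -> : D%:R * M'%:R = \sum_(r < D) M'%:R :> R.
    by rewrite sumr_const card_ord -(mulr_natl M'%:R).
  apply: ltr_sum => [|r _]; last exact: small.
  by apply/hasP; exists (Ordinal D0); rewrite ?mem_index_enum.
have s3 : D%:R * M'%:R <= M%:R :> R by rewrite -natrM ler_nat mulnC leq_divM.
have s4 : 2 * x%:R * D%:R <= M%:R :> R by rewrite -!natrM ler_nat.
have := ler_wpM2l (ler0n R x) s1; lra.
Qed.

(** For $n\equiv r$ mod $D$ the integer $n^i-r^i$ is a multiple of $D$, so $p_in^i$ differs from the
    constant $p_ir^i$ by a multiple of the near-integer $Dp_i$. The terms above degree $j$ thus
    freeze on the progression. *)
Lemma truncation_near_int (k j D r t : nat) tau p : (size p <= k.+1)%N -> (0 < D)%N ->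
  (forall i, (j < i <= k)%N -> near_int (D%:R * p`_i) tau) ->
  0 <= tau ->
  near_int (p.[(t * D + r)%:R] - ((take_poly j.+1 p).[(t * D + r)%:R] +
     \sum_(i < k.+1 | (j < i)%N) p`_i * r%:R ^+ i))
    (k.+1%:R * ((t * D + r) ^ k)%:R * tau).
Proof.
move=> sp D0 near tau0.
have st : (size (take_poly j.+1 p) <= k.+1)%N.
  by apply/leq_sizeP => i ki; rewrite coef_take_poly (leq_sizeP _ _ sp) // if_same.
set n := (t * D + r)%N.
have -> : p.[n%:R] - ((take_poly j.+1 p).[n%:R] + \sum_(i < k.+1 | (j < i)%N) p`_i * r%:R ^+ i) =
    \sum_(i < k.+1) (if (j < i)%N then p`_i * (n%:R ^+ i - r%:R ^+ i) else 0).
  apply/eqP; rewrite subr_eq (horner_coef_wide _ sp) (horner_coef_wide _ st).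
  apply/eqP.
  transitivity (\sum_(i < k.+1) ((take_poly j.+1 p)`_i * n%:R ^+ i +
      (if (j < i)%N then p`_i * r%:R ^+ i else 0) +
      (if (j < i)%N then p`_i * (n%:R ^+ i - r%:R ^+ i) else 0))).
    by apply: eq_bigr => i _; rewrite coef_take_poly ltnS; case: leqP => _; ring.
  by rewrite !big_split /= [X in _ = _ + (_ + X)]big_mkcond [RHS]addrC.
have -> : k.+1%:R * (n ^ k)%:R * tau = \sum_(i < k.+1) (n ^ k)%:R * tau.
  by rewrite sumr_const card_ord -(mulr_natl (_ * tau)) mulrA.
apply: near_int_sum => i _.
case: leqP => [ij|ji]; first by apply: near_int0; rewrite mulr_ge0.
rewrite -!natrX -natrB; last first.
  by rewrite leq_exp2r ?leq_addl // (leq_trans _ ji).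
have /dvdnP [s sE] : (D %| n ^ i - r ^ i)%N.
  by rewrite -eqn_mod_dvd ?leq_exp2r ?leq_addl ?(leq_trans _ ji) // -modnXm /n modnMDl modnXm.
rewrite sE natrM mulrCA [p`_i * _]mulrC.
have := near_intMn s (near i _); rewrite ji -ltnS ltn_ord => /(_ isT).
apply: near_int_le; rewrite ler_wpM2r // ler_nat.
apply: (@leq_trans (n ^ i)).
  by apply: leq_trans (leq_subr (r ^ i) _); rewrite sE leq_pmulr.
have [->|n0] := posnP n; first by rewrite exp0n ?(leq_trans _ ji).
by rewrite leq_pexp2l // -ltnS.
Qed.

(* The coefficients are recovered from the top, one scale for each: once the
   coefficients above [p`_j] are known to be nearly rational with denominator [D],
   they are negligible along progressions of step [D] at the next, much smaller scale. *)
Lemma near_int_coefs (k i : nat) : (i <= k)%N ->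
  exists D W : nat -> nat, elem D /\ elem W /\
  forall x, (0 < x)%N -> [/\ (0 < D x)%N, (0 < W x)%N &
  forall p ms, (size p <= k.+1)%N -> size ms = i ->
    sorted (growth k (W x)) ms -> all (leq (W x)) ms ->
    (forall m, m \in ms -> m%:R <= x%:R * cnorm (esum m (fun n => p.[n%:R]))) ->
    forall j, (k - i < j <= k)%N ->
      near_int ((D x)%:R * p`_j) ((W x)%:R / (head 0 ms)%N%:R)].
Proof.
elim: i => [|i IH] ik.
  exists (fun=> 1%N), (fun=> 1%N); split; first by auto with elem.
  split; first by auto with elem.
  by move=> x x0; split => // p ms _ _ _ _ _ j; rewrite subn0; lia.
have [D [W [eD [eW {}IH]]]] := IH (ltnW ik).
pose j0 := (k - i)%N; have j00 : (0 < j0)%N by rewrite subn_gt0.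
have [D' [W' [eD' [eW' lead]]]] := near_int_lead R j0.-1.
rewrite prednK // in lead.
(* On a progression of step [D x] the leading coefficient becomes $D^{j_0}p_{j_0}$, whence the power
   of [D x]; the remaining factor [D x] serves the coefficients already found. *)
exists (fun x => D x * (D' (4 * x) * D x ^ j0))%N.
(* The summands provide, in order: the length needed by [esum_residue], a truncation error of at
   most $1/(4x)$ per term, the accuracy for $p_{j_0}$ at length about $M/D$, the rescaling of the
   earlier approximations to the new denominator, and positivity. *)
exists (fun x => 2 * x * D x + 32 * x * k.+1 * W x + 2 * D x ^ 2 * W' (4 * x)
   + D' (4 * x) * D x ^ j0 * W x + 1)%N.
have e1 := elem_comp eD'; have e2 := elem_comp eW'.
split; first by auto 10 with elem.
split; first by auto 20 with elem.
move=> x x0; have [D0 W0 {}IH] := IH x x0.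
have x40 : (0 < 4 * x)%N by rewrite muln_gt0.
have [D'0 {}lead] := lead _ x40.
set Wn := (_ + 1)%N; have Wn0 : (0 < Wn)%N by rewrite /Wn addn1.
split => //; first by rewrite !muln_gt0 D0 D'0 expn_gt0 D0.
move=> p [//|M ms] sp [sms] srt /= /andP[WM alls] big.
have M0 : (0 < M)%N by apply: leq_trans WM.
have WWn : (W x <= Wn)%N.
  rewrite /Wn; apply: (@leq_trans (32 * x * k.+1 * W x)); last by lia.
  by rewrite leq_pmull // !muln_gt0 x0.
have near j : (j0 < j <= k)%N ->
    near_int ((D x)%:R * p`_j) ((W x)%:R / (Wn * M ^ k)%:R).
  move=> hj; case: ms sms srt alls big => [s0|m ms sms /= /andP[g srt] alls big].
    by move: hj s0 => /=; rewrite /j0; lia.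
  have WMm : (Wn * M ^ k <= m)%N by [].
  have Wm0 : (0 < Wn * M ^ k)%N by rewrite muln_gt0 Wn0 expn_gt0 M0.
  have /near_int_le : near_int ((D x)%:R * p`_j) ((W x)%:R / m%:R).
    apply: (IH p (m :: ms) sp sms).
    - by apply: sub_path srt => a b; apply: leq_trans; rewrite leq_mul2r WWn orbT.
    - by apply: sub_all (alls : all (leq Wn) (m :: ms)) => a; apply: leq_trans.
    - by move=> a am; apply: big; rewrite inE am orbT.
    by move: hj; rewrite /j0; lia.
  apply.
  by rewrite /= ler_wpM2l // lef_pV2 ?posrE ?ltr0n ?(leq_trans Wm0) // ler_nat.
pose tau : R := (W x)%:R / (Wn * M ^ k)%:R.
have tau0 : 0 <= tau by rewrite divr_ge0.
have WnR : 0 < Wn%:R :> R by rewrite ltr0n.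
have MR : 0 < M%:R :> R by rewrite ltr0n.
have MkR : 0 < (M ^ k)%:R :> R by rewrite ltr0n expn_gt0 M0.
have xR : 0 < x%:R :> R by rewrite ltr0n.
have xDM : (2 * x * D x <= M)%N by apply: leq_trans WM; rewrite /Wn -!addnA leq_addr.
have bigM := big M (mem_head _ _).
have [r rD bigr] := esum_residue x0 D0 xDM bigM.
set M' := (M %/ D x)%N in bigr.
pose q := take_poly j0.+1 p \Po ((D x)%:R *: 'X + r%:R%:P).
pose c := \sum_(a < k.+1 | (j0 < a)%N) p`_a * r%:R ^+ a.
have qE t : q.[t%:R] = (take_poly j0.+1 p).[(t * D x + r)%:R].
  by rewrite /q horner_comp !hornerE natrD natrM mulrC.
(* The sum over the progression is at least $M'/(2x)$ in modulus; truncation loses at most half of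
   this, so $q$ satisfies the hypothesis of [lead] with $4x$. *)
have close : cnorm (esum M' (fun t => p.[(t * D x + r)%:R])) <=
    cnorm (esum M' (fun t => q.[t%:R])) + M'%:R * (4 * x%:R)^-1.
  have -> : esum M' (fun t => p.[(t * D x + r)%:R]) =
      \sum_(t < M') (expi p.[(t * D x + r)%:R] - expi (q.[t%:R] + c)) +
      expi c * esum M' (fun t => q.[t%:R]).
    rewrite mulr_sumr -big_split /=; apply: eq_bigr => t _.
    by rewrite expiD [expi c * _]mulrC subrK.
  apply: le_trans (cnormD _ _) _; rewrite cnormM cnorm_expi mul1r addrC lerD2l.
  apply: le_trans (cnorm_sum _ _ _) _.
  have -> : M'%:R * (4 * x%:R)^-1 = \sum_(t < M') (4 * x%:R)^-1 :> R.
    by rewrite sumr_const card_ord -(mulr_natl (_^-1)).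
  apply: ler_sum => t _; rewrite qE.
  apply: le_trans (cnorm_expi_dist (truncation_near_int _ _ sp D0 near tau0)) _.
  rewrite /tau; set n := (t * D x + r)%N.
  have nM : (n ^ k <= M ^ k)%N.
    case: (k) => // k'; rewrite leq_exp2r // /n.
    apply: (@leq_trans (t.+1 * D x)); first by rewrite mulSn addnC leq_add2r ltnW.
    apply: leq_trans (leq_divM M (D x)); rewrite leq_mul2r; apply/orP; right.
    exact: ltn_ord.
  have nMR : (n ^ k)%:R <= (M ^ k)%:R :> R by rewrite ler_nat.
  have h32 : 32 * x%:R * k.+1%:R * (W x)%:R <= Wn%:R :> R.
    by rewrite -!natrM ler_nat /Wn -!addnA (leq_trans _ (leq_addl _ _)) ?leq_addr.
  rewrite natrM; set m := (M ^ k)%:R in MkR nMR *; set n' := (n ^ k)%:R in nMR *.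
  rewrite -[leRHS]mul1r ler_pdivlMr ?mulr_gt0 //.
  have -> : 8 * (k.+1%:R * n' * ((W x)%:R / (Wn%:R * m))) * (4 * x%:R) =
     (32 * x%:R * k.+1%:R * (W x)%:R) / Wn%:R * (n' / m).
    by field; rewrite !gt_eqF.
  have a1 : 32 * x%:R * k.+1%:R * (W x)%:R / Wn%:R <= 1 :> R by rewrite ler_pdivrMr ?mul1r.
  have a2 : n' / m <= 1 by rewrite ler_pdivrMr ?mul1r.
  have b1 : 0 <= 32 * x%:R * k.+1%:R * (W x)%:R / Wn%:R :> R by rewrite divr_ge0 ?mulr_ge0.
  have b2 : 0 <= n' / m by rewrite divr_ge0.
  by rewrite -[leRHS]mul1r; exact: ler_pM.
have M'0 : (0 < M')%N.
  rewrite divn_gt0 //; apply: leq_trans xDM; rewrite -mulnA mulnA.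
  by rewrite leq_pmull // muln_gt0.
have bigq : M'%:R <= (4 * x)%:R * cnorm (esum M' (fun t => q.[t%:R])).
  have : 2 * x%:R * (M'%:R * (4 * x%:R)^-1) = M'%:R / 2 :> R.
    by field; rewrite gt_eqF.
  have h2x : 0 <= 2 * x%:R :> R by rewrite mulr_ge0.
  have := ler_wpM2l h2x close; rewrite natrM; lra.
have sq : (size q <= j0.+1)%N.
  apply: size_comp_affine; exact: size_take_poly.
have := lead M' q sq M'0 bigq.
rewrite /q (coef_comp_affine_lead _ _ (size_take_poly _ _)) coef_take_poly ltnSn.
move=> nearj0 j hj.
have [jj0|jj0] := eqVneq j j0; last first.
  have hj' : (j0 < j <= k)%N.
    case/andP: hj => h1 ->; rewrite andbT ltn_neqAle eq_sym jj0 /=.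
    by rewrite -(prednK j00) /j0 -subnS.
  have := near_intMn (D' (4 * x) * D x ^ j0)%N (near j hj').
  have -> : (D x * (D' (4 * x) * D x ^ j0))%:R * p`_j =
    (D' (4 * x)%N * D x ^ j0)%N%:R * ((D x)%:R * p`_j).
    by rewrite natrM; ring.
  apply: near_int_le; rewrite mulrA -natrM ler_pdivrMr; last first.
    by rewrite ltr0n muln_gt0 Wn0 expn_gt0 M0.
  rewrite mulrAC -mulrA -[leLHS]mulr1; apply: ler_pM => //.
    by rewrite ler_nat /Wn (leq_trans _ (leq_addr _ _)) // leq_addl.
  rewrite ler_pdivlMr // mul1r ler_nat (@leq_trans (M ^ k)) ?leq_pmull //.
  by rewrite -{1}[M]expn1 leq_pexp2l // (leq_trans _ ik).
rewrite jj0; have := near_intMn (D x) nearj0.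
have -> : (D x)%:R * ((D' (4 * x)%N)%:R * ((D x)%:R ^+ j0 * p`_j0)) =
   (D x * (D' (4 * x) * D x ^ j0))%:R * p`_j0.
  by rewrite !natrM natrX; ring.
apply: near_int_le.
have MM' : M%:R <= 2 * (D x)%:R * M'%:R :> R.
  rewrite -!natrM ler_nat {1}(divn_eq M (D x)) -/M' -mulnA [(D x * _)%N]mulnC mul2n -addnn.
  by rewrite leq_add2l (leq_trans (ltnW (ltn_pmod _ D0))) // leq_pmull.
have M'R : 0 < M'%:R :> R by rewrite ltr0n.
have h2 : 2 * (D x)%:R ^+ 2 * (W' (4 * x)%N)%:R <= Wn%:R :> R.
  rewrite -natrX -!natrM ler_nat /Wn.
  by rewrite -addnA -addnA (leq_trans _ (leq_addl _ _)) // leq_addr.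
rewrite mulrA ler_pdivrMr // mulrAC ler_pdivlMr //.
have := ler_wpM2l (mulr_ge0 (ler0n R (D x)) (ler0n R (W' (4 * x)%N))) MM'.
have := ler_wpM2r (ltW M'R) h2; lra.
Qed.

End AllCoefficients.

(** * Simultaneous recurrence *)

Section Recurrence.
Variable R : realType.
Implicit Types (p : {poly R}) (ps : seq {poly R}) (s : seq nat).

(** Numbers the arcs of length $1/(m+1)$ of $\mathbb R/\mathbb Z$. The remainder is below $m+1$, so
    the default of [inord] never occurs. *)
Definition cell (m : nat) (y : R) : 'I_m.+1 :=
  inord `|Num.floor (m.+1%:R * y) %% m.+1%:Z|%Z%N.

Lemma near_int_cell m (y y' : R) : cell m y = cell m y' ->
  near_int (y - y') (m.+1%:R^-1).
Proof.
set a := Num.floor (m.+1%:R * y); set b := Num.floor (m.+1%:R * y').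
have m0 : m.+1%:Z != 0 by [].
have val (z : int) : `|(z %% m.+1%:Z)%Z|%N%:Z = (z %% m.+1%:Z)%Z.
  by rewrite gez0_abs // modz_ge0.
have lt (z : int) : (`|(z %% m.+1%:Z)%Z| < m.+1)%N.
  by rewrite -ltz_nat val ltz_mod.
move/(congr1 (@nat_of_ord _)); rewrite /cell -/a -/b !inordK // => /(congr1 Posz).
rewrite !val => e; exists ((a %/ m.+1%:Z)%Z - (b %/ m.+1%:Z)%Z).
have M0 : 0 < m.+1%:R :> R by rewrite ltr0n.
have fl (z : R) : exists2 t : R, 0 <= t < 1 &
    z = (Num.floor z %/ m.+1%:Z)%Z%:~R * m.+1%:R + (Num.floor z %% m.+1%:Z)%Z%:~R + t.
  exists (z - (Num.floor z)%:~R).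
    have /andP[] := floor_itv z; rewrite intrD; lra.
  have -> : (Num.floor z)%:~R = (Num.floor z %/ m.+1%:Z)%Z%:~R * m.+1%:R +
      (Num.floor z %% m.+1%:Z)%Z%:~R :> R.
    by rewrite {1}(divz_eq (Num.floor z) m.+1%:Z) intrD intrM.
  ring.
have [t /andP[t0 t1] yE] := fl (m.+1%:R * y).
have [t' /andP[t'0 t'1] yE'] := fl (m.+1%:R * y').
rewrite -/a in yE; rewrite -/b -e in yE'.
have -> : y - y' - ((a %/ m.+1%:Z)%Z - (b %/ m.+1%:Z)%Z)%:~R = (t - t') / m.+1%:R.
  apply: (mulfI (lt0r_neq0 M0)); rewrite mulrBr mulrBr yE yE' intrB.
  by field; rewrite nat1r lt0r_neq0.
rewrite normrM [X in _ * X]gtr0_norm ?invr_gt0 // ler_piMl ?invr_ge0 ?ler0n //.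
by rewrite ler_norml; apply/andP; split; lra.
Qed.

(** The most recently chosen term is at the head, so the prefixes of [s'] are the intervals that end
    just before [x]. *)
Fixpoint almost_additive ps (delta : R) s : Prop :=
  if s is x :: s' then almost_additive ps delta s' /\
    forall p i, p \in ps -> near_int
      (p.[(sumn (take i s') + x)%:R] - p.[(sumn (take i s'))%:R] - p.[x%:R]) delta
  else True.

Lemma almost_additive_drop ps delta s a :
  almost_additive ps delta s -> almost_additive ps delta (drop a s).
Proof. by elim: s a => [|x s IH] [|a] //= [/IH]. Qed.

Lemma almost_additive_sum ps delta s : 0 <= delta ->
  (forall p, p \in ps -> p.[0] = 0) -> almost_additive ps delta s ->
  forall p i, p \in ps ->
    near_int (p.[(sumn (take i s))%:R] - \sum_(c <- take i s) p.[c%:R])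
             ((size s)%:R * delta).
Proof.
move=> d0 ps0; elim: s => [|x s IH] /= good p [|i] pps /=.
- by rewrite big_nil ps0 // subr0; apply: near_int0; rewrite mul0r.
- by rewrite big_nil ps0 // subr0; apply: near_int0; rewrite mul0r.
- by rewrite big_nil ps0 // subr0; apply: near_int0; rewrite mulr_ge0.
have [good' h] := good; have := near_intD (IH good' p i pps) (h p i pps).
rewrite big_cons -natr1 mulrDl mul1r addnC; congr near_int; ring.
Qed.

(* Choose [x_1, ..., x_N] one after the other so that, for every interval sum [y]
   ending at the previous term, the polynomial [p(y + X) - p(y) - p(X)], of smaller
   degree than [p], is almost an integer at the next term. Then [p] is almost additive
   on interval sums, and the pigeonhole principle for the partial sums of the [p(x_c)]
   gives an interval. *)
Lemma simultaneous_recurrence (k : nat) : exists Q : nat -> nat, elem Q /\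
  forall x ps, (0 < x)%N -> (size ps <= x)%N ->
    (forall p, p \in ps -> (size p <= k.+1)%N /\ p.[0] = 0) ->
  exists q, (0 < q <= Q x)%N /\ forall p, p \in ps -> near_int p.[q%:R] (x%:R^-1).
Proof.
elim: k => [|k [Q [eQ IH]]].
  exists (fun=> 1%N); split; first by auto with elem.
  move=> x ps x0 _ h; exists 1%N; split => // p /h [sp p0].
  have pc : p = (p`_0)%:P by apply: size1_polyC.
  by move: p0; rewrite pc !hornerC => ->; apply: near_int0; rewrite invr_ge0.
(* [N] bounds the number of colours: one of $2x$ arcs for each of at most $x$ polynomials. [X]
   bounds the number of lower degree polynomials to be treated at once, and $N+1$ errors of size
   $1/X$ add up to $1/(2x)$. *)
pose N x := ((2 * x) ^ x)%N.
pose X x := (2 * x * (N x).+1)%N.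
exists (fun x => N x * Q (X x))%N.
have eQX : elem (fun x => Q (X x)) by apply: (elem_comp eQ); rewrite /X /N; auto 20 with elem.
split; first by rewrite /N; auto 20 with elem.
move=> x ps x0 sps hps.
have X0 : (0 < X x)%N by rewrite !muln_gt0 x0.
have build d : (d <= N x)%N -> exists s, [/\ size s = d,
    almost_additive ps (X x)%:R^-1 s & all (fun c => (0 < c <= Q (X x))%N) s].
  elim: d => [|d IHd] dN; first by exists [::].
  have [s [sd add als]] := IHd (ltnW dN).
  pose g y p := p \Po (1 *: 'X + y%:R%:P) - p - p.[y%:R]%:P.
  pose L := [seq g y p | y <- [seq sumn (take i s) | i <- iota 0 d.+1], p <- ps].
  have gE y p n : (g y p).[n%:R] = p.[(y + n)%:R] - p.[n%:R] - p.[y%:R].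
    by rewrite addnC natrD /g !hornerD !hornerN horner_comp !hornerE.
  have sL : (size L <= X x)%N.
    rewrite size_allpairs size_map size_iota /X mulnC leq_mul ?ltnS ?(ltnW dN) //.
    by rewrite (leq_trans sps) // leq_pmull.
  have hL p : p \in L -> (size p <= k.+1)%N /\ p.[0] = 0.
    case/allpairsP => -[y r] /= [_ rps ->]; have [sr r0] := hps r rps; split.
      apply/leq_sizeP => j kj; rewrite /g !coefB coefC.
      have -> : (j == 0)%N = false by apply/eqP; lia.
      move: kj; rewrite leq_eqVlt subr0 => /orP[/eqP<-|kj].
        by rewrite (coef_comp_affine_lead _ _ sr) expr1n mul1r subrr.
      by rewrite (leq_sizeP _ _ (size_comp_affine _ _ sr)) ?(leq_sizeP _ _ sr) ?subrr.
    by have := gE y r 0%N; rewrite addn0 r0 subr0 subrr.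
  have [c [/andP[c0 cQ] hc]] := IH _ _ X0 sL hL.
  exists (c :: s); split => /=; [by rewrite sd | split => // | by rewrite c0 cQ].
  move=> p i pps; pose i' := minn i d.
  have -> : take i s = take i' s.
    rewrite /i' /minn; case: ltnP => // di.
    by rewrite !take_oversize ?sd.
  have : g (sumn (take i' s)) p \in L.
    apply/allpairsP; exists (sumn (take i' s), p); split => //; rewrite [X in X \in _]/fst.
    by apply/mapP; exists i' => //; rewrite mem_iota add0n ltnS leq0n geq_minr.
  by move/hc; rewrite gE addrAC.
have [s [sN add als]] := build _ (leqnn _).
pose h (p : {poly R}) b := \sum_(c <- drop b s) p.[c%:R].
(* There are $N+1$ suffixes. Two of the same colour leave an interval between them over which every
   sum of the $p(c)$ is within $1/(2x)$ of an integer. *)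
pose col (b : 'I_(N x).+1) : {ffun 'I_(size ps) -> 'I_(2 * x).-1.+1} :=
  [ffun i => cell _ (h (tnth (in_tuple ps) i) b)].
have [a [b [ab cab]]] : exists a b : 'I_(N x).+1, (a < b)%N /\ col a = col b.
  apply: contrapT => no.
  have inj : injective col.
    move=> a b cab; apply/val_inj/eqP; rewrite /= eqn_leq leqNgt [X in _ && X]leqNgt.
    by apply/andP; split; apply/negP => lt; apply: no; [exists b, a | exists a, b].
  have := leq_card _ inj; rewrite card_ord card_ffun !card_ord prednK ?muln_gt0 ?x0 //.
  rewrite leqNgt ltnS /N leq_pexp2l // muln_gt0 x0 //.
have xR : 0 < x%:R :> R by rewrite ltr0n.
pose t := take (b - a) (drop a s).
have bN : (b <= N x)%N by rewrite -ltnS.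
have st : size t = (b - a)%N.
  by rewrite size_take size_drop sN; case: ltnP => //; lia.
have alt c : c \in t -> (0 < c <= Q (X x))%N.
  by move/mem_take/mem_drop; exact: (allP als).
exists (sumn t); split.
  apply/andP; split.
    case: t st alt => [|c t] /= st alt; first by lia.
    have /alt /andP[c0 _] := mem_head c t; by rewrite ltn_addr.
  apply: (@leq_trans (size t * Q (X x))); last by rewrite st leq_mul2r; apply/orP; right; lia.
  elim: (t) alt => //= c u IHu alt; rewrite mulSn leq_add //.
    by have /andP[] := alt c (mem_head _ _).
  by apply: IHu => e eu; apply: alt; rewrite inE eu orbT.
move=> p pps.
have n1 : near_int (p.[(sumn t)%:R] - \sum_(c <- t) p.[c%:R]) ((size (drop a s))%:R * (X x)%:R^-1).
  apply: (almost_additive_sum (ps := ps)) => //.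
  - by rewrite invr_ge0.
  - by move=> r /hps [].
  - exact: almost_additive_drop.
have n2 : near_int (h p a - h p b) ((2 * x)%:R^-1).
  have ip : (index p ps < size ps)%N by rewrite index_mem.
  move/ffunP/(_ (Ordinal ip)): cab; rewrite !ffunE (tnth_nth 0) /= nth_index //.
  by move/near_int_cell; rewrite prednK // muln_gt0 x0.
have hab : \sum_(c <- t) p.[c%:R] = h p a - h p b.
  rewrite /h -[in X in _ = X - _](cat_take_drop (b - a) (drop a s)) big_cat /=.
  by rewrite drop_drop subnK ?addrK // ltnW.
have := near_intD n1 n2; rewrite -hab subrK; apply: near_int_le.
have s1 : (size (drop a s))%:R <= (N x).+1%:R :> R by rewrite ler_nat size_drop sN; lia.
have -> : x%:R^-1 = (N x).+1%:R * (X x)%:R^-1 + (2 * x)%:R^-1 :> R.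
  rewrite /X !natrM; field.
  by rewrite ?nat1r ?(gt_eqF xR) ?pnatr_eq0.
by rewrite lerD2r ler_wpM2r // invr_ge0.
Qed.

End Recurrence.

(** * The mass increment *)

Section Clusters.
Local Open Scope complex_scope.
Variables (R : realType) (X : finType).
Implicit Types (w v : X -> R) (N : rel X) (Z : seq X).

Definition covered N Z : pred X := fun xi => has (fun z => N z xi) Z.

(** As long as some neighbourhood has uncovered mass above $1/C$, add its centre; $C+1$ such choices
    would cover mass above 1. *)
Lemma greedy_clusters w N (C : nat) : (0 < C)%N ->
  (forall xi, 0 <= w xi) -> \sum_xi w xi <= 1 ->
  exists Z, (size Z <= C)%N /\
    forall eta, \sum_(xi | ~~ covered N Z xi && N eta xi) w xi <= C%:R^-1.
Proof.
move=> C0 w0 w1; apply: contrapT => no.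
have CR : 0 < C%:R :> R by rewrite ltr0n.
have build m : (m <= C.+1)%N ->
    exists Z, size Z = m /\ m%:R * C%:R^-1 <= \sum_(xi | covered N Z xi) w xi.
  elim: m => [|m IH] mC; first by exists [::]; rewrite mul0r sumr_ge0.
  have [Z [sZ hZ]] := IH (ltnW mC).
  have [eta heta] : exists eta, C%:R^-1 < \sum_(xi | ~~ covered N Z xi && N eta xi) w xi.
    apply: contrapT => noeta; apply: no; exists Z; rewrite sZ; split => // eta.
    by rewrite leNgt; apply/negP => h; apply: noeta; exists eta.
  exists (eta :: Z); rewrite /= sZ; split => //.
  rewrite (bigID (covered N Z)) /= -natr1 mulrDl mul1r; apply: lerD.
    rewrite (eq_bigl (covered N Z)) // => xi; rewrite /covered /=.
    by case: (has _ Z); rewrite ?andbF ?orbT.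
  apply/ltW; rewrite (eq_bigl (fun xi => ~~ covered N Z xi && N eta xi)) // => xi.
  by rewrite /covered /=; case: (has _ Z); rewrite ?andbF ?orbF ?andbT.
have [Z [_ hZ]] := build _ (leqnn _).
have : \sum_(xi | covered N Z xi) w xi <= 1.
  by apply: le_trans w1; rewrite [leRHS](bigID (covered N Z)) /= lerDl sumr_ge0.
move/(le_trans hZ); rewrite ler_pdivrMr // mul1r ler_nat ltnn //.
Qed.

Lemma sum_scales_le (S C k : nat) (P : pred nat) (g : nat -> R) :
  (forall s, g s <= 1) -> (forall s, ~~ P s -> g s <= C%:R^-1) ->
  (count P (iota 0 S) <= k)%N ->
  \sum_(s <- iota 0 S) g s <= S%:R / C%:R + k%:R.
Proof.
move=> g1 gC ck; rewrite (bigID P) /= addrC; apply: lerD.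
  apply: (@le_trans _ _ (\sum_(s <- iota 0 S) C%:R^-1)).
    rewrite big_mkcond; apply: ler_sum => s _.
    by case: ifP => [/gC//|_]; rewrite invr_ge0.
  by rewrite big_const_seq count_predT size_iota iter_addr_0 -(mulr_natl (_^-1)).
apply: (@le_trans _ _ (count P (iota 0 S))%:R); last by rewrite ler_nat.
rewrite -sum1_count natr_sum; apply: ler_sum => s _; exact: g1.
Qed.

(** After expanding the square, pairs related by [N] have total weight at most $1/C$ and contribute
    at most $S/C$ over all scales. Every other pair is correlated at no more than $k$ scales and
    contributes less than $1/C$ at the rest. *)
Lemma light_second_moment v N (phi : X -> nat -> R) (C k S : nat) (M : nat -> nat) :
  (0 < C)%N -> (forall s, 0 < M s)%N ->
  (forall xi, 0 <= v xi) -> \sum_xi v xi <= 1 ->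
  (forall eta, \sum_(xi | N eta xi) v xi <= C%:R^-1) ->
  (forall eta xi, ~~ N eta xi ->
    (count (fun s => ((M s)%:R <= C%:R * cnorm (esum (M s) (fun n => phi xi n - phi eta n)))%R)
      (iota 0 S) <= k)%N) ->
  \sum_(s <- iota 0 S) (M s)%:R^-1 *
     \sum_(n < M s) cnorm (\sum_xi (v xi)%:C * expi (phi xi n)) ^+ 2
  <= 2 * (S%:R / C%:R) + k%:R.
Proof.
move=> C0 M0 v0 v1 light sparse.
have CR : 0 < C%:R :> R by rewrite ltr0n.
pose E eta xi s := (M s)%:R^-1 * cnorm (esum (M s) (fun n => phi xi n - phi eta n)).
have E1 eta xi s : E eta xi s <= 1.
  by rewrite /E mulrC ler_pdivrMr ?ltr0n // mul1r cnorm_esum_le.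
apply: (@le_trans _ _ (\sum_(s <- iota 0 S) \sum_xi \sum_eta v xi * v eta * E eta xi s)).
  apply: ler_sum => s _; apply: (@le_trans _ _ ((M s)%:R^-1 *
    \sum_xi \sum_eta v xi * v eta * cnorm (esum (M s) (fun n => phi xi n - phi eta n)))).
    by rewrite ler_wpM2l ?invr_ge0 // second_moment.
  rewrite mulr_sumr; apply: ler_sum => xi _; rewrite mulr_sumr; apply: ler_sum => eta _.
  by rewrite mulrCA.
rewrite exchange_big /=.
under eq_bigr do rewrite exchange_big /=.
rewrite exchange_big /=.
have SC0 : 0 <= S%:R / C%:R :> R by rewrite divr_ge0.
apply: (@le_trans _ _ (\sum_eta v eta * (2 * (S%:R / C%:R) + k%:R))); last first.
  by rewrite -mulr_suml ler_piMl // addr_ge0 // mulr_ge0.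
apply: ler_sum => eta _; rewrite (bigID (N eta)) /=.
have -> : 2 * (S%:R / C%:R) + k%:R = S%:R / C%:R + (S%:R / C%:R + k%:R) :> R by ring.
rewrite mulrDr; apply: lerD.
  apply: (@le_trans _ _ (\sum_(xi | N eta xi) v xi * (v eta * S%:R))).
    apply: ler_sum => xi _; apply: (@le_trans _ _ (\sum_(s <- iota 0 S) v xi * v eta)).
      by apply: ler_sum => s _; rewrite ler_piMr // mulr_ge0.
    rewrite big_const_seq count_predT size_iota iter_addr_0 -(mulr_natr (_ * _)).
    by rewrite mulrA.
  rewrite -mulr_suml mulrCA ler_wpM2l // mulrC ler_wpM2l //.
apply: (@le_trans _ _ (\sum_(xi | ~~ N eta xi) v xi * (v eta * (S%:R / C%:R + k%:R)))).
  apply: ler_sum => xi nN; rewrite -mulr_sumr -mulrA ler_wpM2l // ler_wpM2l //.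
  apply: sum_scales_le (sparse _ _ nN) => [s|s]; first exact: E1.
  rewrite -ltNge => h; rewrite /E mulrC ler_pdivrMr ?ltr0n // mulrC ler_pdivlMr //.
  by rewrite mulrC ltW.
rewrite -mulr_suml ler_piMl //; first by rewrite mulr_ge0 // addr_ge0.
by apply: le_trans v1; rewrite [leRHS](bigID (N eta)) /= lerDr sumr_ge0.
Qed.

End Clusters.

Section Step.
Local Open Scope complex_scope.
Variable R : realType.
Implicit Types (p : {poly R}).

(** Each scale is the $(k+1)$-st power of the one before, so $W\le Y$ suffices for [growth]. *)
Definition scale (k Y s : nat) : nat := (Y ^ (k.+1 ^ s))%N.

Lemma scale_ge k Y s : (0 < Y)%N -> (Y <= scale k Y s)%N.
Proof. by move=> Y0; rewrite /scale -{1}[Y]expn1 leq_pexp2l // expn_gt0. Qed.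

Lemma growth_scale k W Y s t : (0 < Y)%N -> (W <= Y)%N -> (s < t)%N ->
  growth k W (scale k Y s) (scale k Y t).
Proof.
move=> Y0 WY st; rewrite /growth /scale -expnM.
apply: (@leq_trans (Y * Y ^ (k.+1 ^ s * k))); first by rewrite leq_mul2r WY orbT.
rewrite -expnS leq_pexp2l // (@leq_trans (k.+1 ^ s.+1)) //.
  by rewrite expnS mulnC mulSn mulnC -add1n leq_add2r expn_gt0.
by rewrite leq_pexp2l.
Qed.

(** Any selection of these scales satisfies [growth], so [near_int_coefs] applies to the first $k$
    at which the sum is large. Contrapositively, phases that are not close correlate at fewer than
    $k$ scales. *)
Lemma near_int_of_many_scales (k : nat) : exists D W : nat -> nat, elem D /\ elem W /\
  forall x, (0 < x)%N -> [/\ (0 < D x)%N, (0 < W x)%N &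
  forall Y S p, (W x <= Y)%N -> (size p <= k.+1)%N ->
    (k <= count (fun s => ((scale k Y s)%:R <=
        x%:R * cnorm (esum (scale k Y s) (fun n => p.[n%:R])))%R) (iota 0 S))%N ->
    forall j, (0 < j <= k)%N -> near_int ((D x)%:R * p`_j) ((W x)%:R / Y%:R)].
Proof.
have [D [W [eD [eW H]]]] := near_int_coefs R (leqnn k).
exists D, W; split => //; split => // x x0; have [D0 W0 {}H] := H x x0.
split => // Y S p WY sp; set P := (fun s => _) => cnt j hj.
have Y0 : (0 < Y)%N by apply: leq_trans WY.
pose fs := take k (seq.filter P (iota 0 S)); pose ms := map (scale k Y) fs.
have sfs : size fs = k by rewrite size_takel // size_filter.
have sms : size ms = k by rewrite size_map.
have bigms m : m \in ms -> m%:R <= x%:R * cnorm (esum m (fun n => p.[n%:R])).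
  by case/mapP => s /mem_take; rewrite mem_filter => /andP[Ps _] ->.
have srt : sorted (growth k (W x)) ms.
  rewrite /ms sorted_map; apply: (@sub_sorted _ ltn).
    by move=> a b; exact: growth_scale.
  by apply: take_sorted; apply: sorted_filter (iota_ltn_sorted _ _); exact: ltn_trans.
have alls : all (leq (W x)) ms.
  by apply/allP => m /mapP[s _ ->]; apply: leq_trans WY (scale_ge _ _ Y0).
have := H p ms sp sms srt alls bigms j; rewrite subnn => /(_ hj).
apply: near_int_le; rewrite ler_wpM2l // lef_pV2 ?posrE ?ltr0n // ?ler_nat.
  rewrite /ms; case: fs sfs {ms sms bigms srt alls} => [|s fs] /= sfs; first by move: hj; lia.
  exact: scale_ge.
case: ms sms {bigms srt} alls => [|m ms] /= sms; first by move: hj; lia.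
by case/andP=> Wm _; apply: leq_trans Wm.
Qed.

(** $p_j(Dm)^j$ is $D^{j-1}m^j$ times the near-integer $Dp_j$. *)
Lemma near_int_horner (k D N m : nat) tau p : (size p <= k.+1)%N -> p.[0] = 0 ->
  0 <= tau -> (0 < m)%N -> (m <= N)%N -> (0 < D)%N ->
  (forall j, (0 < j <= k)%N -> near_int (D%:R * p`_j) tau) ->
  near_int p.[(D * m)%:R] (k.+1%:R * (((D * N) ^ k)%:R * tau)).
Proof.
move=> sp p0 tau0 m0 mN D0 near; rewrite (horner_coef_wide _ sp).
have -> : k.+1%:R * (((D * N) ^ k)%:R * tau) = \sum_(j < k.+1) ((D * N) ^ k)%:R * tau.
  by rewrite sumr_const card_ord -(mulr_natl (_ * tau)).
apply: near_int_sum => j _; case: j => [[|j] hj] /=.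
  have -> : p`_0 = 0 by rewrite -horner_coef0 p0.
  by rewrite mul0r; apply: near_int0; rewrite mulr_ge0.
have := near_intMn (D ^ j * m ^ j.+1)%N (near j.+1 hj).
have -> : (D ^ j * m ^ j.+1)%:R * (D%:R * p`_j.+1) = p`_j.+1 * (D * m)%:R ^+ j.+1.
  rewrite !natrM !natrX exprMn [D%:R ^+ j.+1]exprS.
  by move: (D%:R ^+ j) (m%:R ^+ j.+1) => a b; ring.
apply: near_int_le; rewrite ler_wpM2r // ler_nat.
apply: (@leq_trans ((D * N) ^ j.+1)).
  by rewrite expnMn leq_mul ?leq_exp2r // leq_pexp2l.
by rewrite leq_pexp2l // muln_gt0 D0 (leq_trans m0).
Qed.

Definition cos_sum (X : finType) (w : X -> R) (p : X -> {poly R}) (n : nat) : R :=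
  \sum_xi w xi * complex.Re (expi (p xi).[n%:R]).

(** If clusters are heavy for some $i$, recurrence for their centres gives the second alternative.
    Otherwise, failure of the first would keep the second moment of the remaining phases bounded
    below at every scale, against [light_second_moment]. *)
Lemma increment_step (k : nat) : (0 < k)%N -> exists F : nat -> nat, elem F /\
  forall (y x0 H l : nat) (X : finType) (w : 'I_l -> X -> R) (p : 'I_l -> X -> {poly R}),
  (0 < x0 <= y)%N -> (0 < H <= y)%N -> (l <= y)%N ->
  (forall i xi, 0 <= w i xi) -> (forall i, \sum_xi w i xi <= 1) ->
  (forall i xi, (size (p i xi) <= k.+1)%N) -> (forall i xi, (p i xi).[0] = 0) ->
  (exists2 n, (0 < n <= F y)%N & forall i, - x0%:R^-1 <= cos_sum (w i) (p i) n) \/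
  (exists q (U : 'I_l -> pred X), [/\ (0 < q)%N, (q * H <= F y)%N,
     exists i, (2 * x0%:R)^-1 <= \sum_(xi | U i xi) w i xi &
     forall i xi m, U i xi -> (0 < m <= H)%N ->
       0 <= complex.Re (expi (p i xi).[(q * m)%:R])]).
Proof.
move=> k0; have [D [W [eD [eW many]]]] := near_int_of_many_scales k.
have [Q [eQ rec]] := simultaneous_recurrence R k.
(* Closeness threshold [1 / C]: the final contradiction needs [24 * l * x0 ^ 2 < C]. *)
pose C y := (25 * y ^ 3)%N.
(* [xr] bounds the number of polynomials from all $i$, centres and $m\le H$, and its factor 8 gives
   accuracy $1/8$. [Y] keeps the deviation from a centre below $1/8$, and [S] turns the bound
   $2S/C+k$ into $3k$. *)
pose xr y := (8 * (y * y * C y))%N.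
pose N y := (Q (xr y) * y)%N.
pose Y y := (8 * k.+1 * (D (C y) * N y) ^ k * W (C y) + (W (C y)).+1)%N.
pose S y := (k * C y)%N.
have eC : elem C by rewrite /C; auto 10 with elem.
have eDC := elem_comp eD eC; have eWC := elem_comp eW eC.
have exr : elem xr by rewrite /xr; auto 10 with elem.
have eQx := elem_comp eQ exr.
have eN : elem N by rewrite /N; auto 10 with elem.
have eY : elem Y by rewrite /Y; auto 20 with elem.
have eS : elem S by rewrite /S; auto 10 with elem.
exists (fun y => D (C y) * N y + scale k (Y y) (S y))%N; split.
  by rewrite /scale; auto 20 with elem.
move=> y x0 H l X w p /andP[x00 x0y] /andP[H0 Hy] ly w0 w1 sp p0.
have y0 : (0 < y)%N by apply: leq_trans x0y.
have C0 : (0 < C y)%N by rewrite /C muln_gt0 expn_gt0 y0.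
have [D0 W0 {}many] := many _ C0.
have WY : (W (C y) < Y y)%N by rewrite /Y leq_addl.
have Y0 : (0 < Y y)%N by apply: leq_trans WY.
pose tau : R := (W (C y))%:R / (Y y)%:R.
have tau0 : 0 <= tau by rewrite divr_ge0.
pose close i : rel X := fun eta xi =>
  `[< forall j, (0 < j <= k)%N -> near_int ((D (C y))%:R * (p i xi - p i eta)`_j) tau >].
have [Z hZ] : exists Z : 'I_l -> seq X, forall i, (size (Z i) <= C y)%N /\
    forall eta, \sum_(xi | ~~ covered (close i) (Z i) xi && close i eta xi) w i xi <= (C y)%:R^-1.
  have /choice : forall i, exists Zi, (size Zi <= C y)%N /\
    forall eta, \sum_(xi | ~~ covered (close i) Zi xi && close i eta xi) w i xi <= (C y)%:R^-1.
    by move=> i; apply: greedy_clusters.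
  by case=> Z hZ; exists Z.
pose U i := covered (close i) (Z i).
have x0R : 0 < x0%:R :> R by rewrite ltr0n.
have [heavy|light] := pselect (exists i, (2 * x0%:R)^-1 <= \sum_(xi | U i xi) w i xi).
  right.
  (* Including $p_z(DmX)$ for each $m\le H$ makes a single $q$ serve all multiples $Dqm$. *)
  pose ps := flatten
    [seq [seq p i z \Po ((D (C y) * m)%:R *: 'X + 0%:P) | z <- Z i, m <- iota 1 H]
    | i <- enum 'I_l].
  have xr0 : (0 < xr y)%N by rewrite /xr muln_gt0 muln_gt0 C0 andbT muln_gt0 y0.
  have sps : (size ps <= xr y)%N.
    rewrite size_flatten /shape -map_comp sumnE big_map.
    apply: (@leq_trans (\sum_(i <- enum 'I_l) (C y * y))%N).
      apply: leq_sum => i _ /=; rewrite size_allpairs size_iota leq_mul //.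
      by have [] := hZ i.
    rewrite big_const_seq count_predT size_enum_ord iter_addn_0 /xr.
    by rewrite [(C y * y)%N]mulnC mulnC mulnA (leq_trans _ (leq_pmull _ _)) // !leq_mul.
  have memps r : r \in ps -> exists i z m, [/\ z \in Z i, m \in iota 1 H &
      r = p i z \Po ((D (C y) * m)%:R *: 'X + 0%:P)].
    case/flattenP => s /mapP[i _ ->] /allpairsP[[z m] /= [zZ mH ->]].
    by exists i, z, m.
  have hps r : r \in ps -> (size r <= k.+1)%N /\ r.[0] = 0.
    case/memps => i [z [m [_ _ ->]]]; split; first exact: size_comp_affine.
    by rewrite horner_comp !hornerE.
  have [q [/andP[q0 qQ] hq]] := rec _ _ xr0 sps hps.
  exists (D (C y) * q)%N, U; split => //.
  - by rewrite muln_gt0 D0.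
  - by rewrite (leq_trans _ (leq_addr _ _)) // -mulnA leq_mul // /N leq_mul.
  move=> i xi m; rewrite /U /covered => /hasP[z zZ /asboolP near] /andP[m0 mH].
  apply: Re_expi_ge0; rewrite -mulnA.
  rewrite -[(p i xi).[_]](subrK (p i z).[(D (C y) * (q * m))%:R]) -hornerN -hornerD.
  (* The distance $1/4$ is split evenly between the centre's value and the deviation from the
     centre. *)
  have n1 : near_int (p i z).[(D (C y) * (q * m))%:R] 8^-1.
    have mem : p i z \Po ((D (C y) * m)%:R *: 'X + 0%:P) \in ps.
      apply/flattenP.
      exists [seq p i z \Po ((D (C y) * m)%:R *: 'X + 0%:P) | z <- Z i, m <- iota 1 H].
        by apply/mapP; exists i => //; rewrite mem_enum.
      by apply/allpairsP; exists (z, m); split => //; rewrite mem_iota m0 add1n ltnS.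
    have h := hq _ mem; rewrite horner_comp !hornerE in h.
    have e : (D (C y) * m)%:R * q%:R = (D (C y) * (q * m))%N%:R :> R by rewrite !natrM; ring.
    move: h; rewrite e.
    apply: near_int_le; rewrite lef_pV2 ?posrE ?ltr0n // /xr natrM ler_peMr //.
    by rewrite ler1n muln_gt0 C0 andbT muln_gt0 y0.
  have n2 : near_int (p i xi - p i z).[(D (C y) * (q * m))%:R] 8^-1.
    have spp : (size (p i xi - p i z)%R <= k.+1)%N.
      by rewrite (leq_trans (size_polyD _ _)) // size_polyN geq_max !sp.
    have pp0 : (p i xi - p i z).[0] = 0 by rewrite hornerD hornerN !p0 subrr.
    have qm0 : (0 < q * m)%N by rewrite muln_gt0 q0.
    have qmN : (q * m <= N y)%N by rewrite /N leq_mul // (leq_trans mH).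
    have := near_int_horner spp pp0 tau0 qm0 qmN D0 near.
    apply: near_int_le; rewrite /tau mulrA mulrA ler_pdivrMr ?ltr0n //.
    rewrite ler_pdivlMl // -!natrM ler_nat /Y mulnA (leq_trans _ (leq_addr _ _)) //.
    by rewrite !mulnA.
  by have := near_intD n2 n1; apply: near_int_le; lra.
left; apply: contrapT => bad.
have Y2 : (1 < Y y)%N by apply: leq_trans WY; rewrite ltnS.
pose v i xi := if U i xi then 0 else w i xi.
pose V i n : R[i] := \sum_xi (v i xi)%:C * expi (p i xi).[n%:R].
have v0 i xi : 0 <= v i xi by rewrite /v; case: ifP.
have v1 i : \sum_xi v i xi <= 1.
  by apply: le_trans (w1 i); apply: ler_sum => xi _; rewrite /v; case: ifP.
(* If this failed at $n$, the clusters and the other phases would each contribute more than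
   $-1/(2x_0)$, and $n$ would be good for all $i$. *)
have lower s n : (s < S y)%N -> (0 < n)%N -> (n < scale k (Y y) s)%N ->
    (2 * x0%:R)^-1 ^+ 2 <= \sum_i cnorm (V i n) ^+ 2.
  move=> sS n0 nM; rewrite leNgt; apply/negP => small; apply: bad; exists n.
    rewrite n0 (leq_trans (ltnW nM)) // (leq_trans _ (leq_addl _ _)) //.
    by rewrite /scale leq_pexp2l // leq_pexp2l // ltnW.
  move=> i; have Vi : cnorm (V i n) < (2 * x0%:R)^-1.
    rewrite -(@ltr_pXn2r _ 2) ?nnegrE ?cnorm_ge0 ?invr_ge0 ?mulr_ge0 //.
    apply: le_lt_trans small; rewrite (bigD1 i) //= lerDl sumr_ge0 // => a _.
    exact: sqr_ge0.
  have Ui : \sum_(xi | U i xi) w i xi < (2 * x0%:R)^-1.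
    by rewrite ltNge; apply/negP => h; apply: light; exists i.
  rewrite /cos_sum (bigID (U i)) /=.
  have a1 : - \sum_(xi | U i xi) w i xi <=
      \sum_(xi | U i xi) w i xi * complex.Re (expi (p i xi).[n%:R]).
    rewrite -sumrN; apply: ler_sum => xi _; rewrite -[leLHS]mulrN1 ler_wpM2l //.
    have := Re_le_cnorm (expi (p i xi).[n%:R]).
    by rewrite cnorm_expi ler_norml => /andP[].
  have a2 : \sum_(xi | ~~ U i xi) w i xi * complex.Re (expi (p i xi).[n%:R]) =
      complex.Re (V i n).
    rewrite /V raddf_sum big_mkcond; apply: eq_bigr => xi _.
    by rewrite /v /=; case: (U i xi) => /=; rewrite !mul0r subr0.
  have a3 : - cnorm (V i n) <= complex.Re (V i n).
    by have := Re_le_cnorm (V i n); rewrite ler_norml => /andP[].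
  rewrite a2; have -> : x0%:R^-1 = (2 * x0%:R)^-1 + (2 * x0%:R)^-1 :> R.
    by field; rewrite gt_eqF.
  lra.
pose T := \sum_(s <- iota 0 (S y)) \sum_i (scale k (Y y) s)%:R^-1 *
  \sum_(n < scale k (Y y) s) cnorm (V i n) ^+ 2.
have upT : T <= l%:R * (3 * k%:R).
  rewrite /T exchange_big /=.
  apply: (@le_trans _ _ (\sum_(i < l) 3 * k%:R)); last first.
    by rewrite sumr_const card_ord -(mulr_natl (3 * _)).
  apply: ler_sum => i _.
  have := @light_second_moment R X (v i) (close i) (fun xi n => (p i xi).[n%:R])
    (C y) k (S y) (scale k (Y y)) C0 _ (v0 i) (v1 i).
  have -> : 2 * ((S y)%:R / (C y)%:R) + k%:R = 3 * k%:R :> R.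
    by rewrite /S natrM mulfK ?pnatr_eq0 -?lt0n //; ring.
  apply.
  - by move=> s; rewrite /scale expn_gt0 Y0.
  - move=> eta; apply: le_trans ((hZ i).2 eta); rewrite big_mkcond [leRHS]big_mkcond.
    apply: ler_sum => xi _; rewrite /v -/(U i).
    by case: (U i xi); case: (close i eta xi).
  move=> eta xi nrel; apply: ltnW; rewrite ltnNge; apply/negP => cnt.
  case/negP: nrel; apply/asboolP => j hj.
  apply: (many (Y y) (S y) (p i xi - p i eta) (ltnW WY)) => //.
    by rewrite (leq_trans (size_polyD _ _)) // size_polyN geq_max !sp.
  apply: leq_trans cnt _; rewrite leq_eqVlt; apply/orP; left; apply/eqP.
  apply: eq_count => s; congr (_ <= _ * cnorm _); apply: eq_bigr => n _.
  by rewrite hornerD hornerN.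
have lowT : (S y)%:R * ((2 * x0%:R)^-1 ^+ 2 / 2) <= T.
  rewrite /T; have -> : (S y)%:R * ((2 * x0%:R)^-1 ^+ 2 / 2) =
      \sum_(s <- iota 0 (S y)) ((2 * x0%:R)^-1 ^+ 2 / 2) :> R.
    by rewrite big_const_seq count_predT size_iota iter_addr_0 -(mulr_natl (_ / 2)).
  rewrite big_seq [leRHS]big_seq; apply: ler_sum => s; rewrite mem_iota add0n => sS.
  rewrite -mulr_sumr exchange_big /=.
  have M2 : (1 < scale k (Y y) s)%N by rewrite (leq_trans Y2) // scale_ge.
  have low : ((scale k (Y y) s).-1)%:R * (2 * x0%:R)^-1 ^+ 2 <=
      \sum_(n < scale k (Y y) s) \sum_i cnorm (V i n) ^+ 2.
    move: (lower s); case: (scale k (Y y) s) M2 => // m m1 low.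
    rewrite big_ord_recl /= -[leLHS]add0r; apply: lerD.
      by rewrite sumr_ge0 // => i _; exact: sqr_ge0.
    have -> : m%:R * (2 * x0%:R)^-1 ^+ 2 = \sum_(n < m) (2 * x0%:R)^-1 ^+ 2 :> R.
      by rewrite sumr_const card_ord -(mulr_natl (_ ^+ 2)).
    by apply: ler_sum => n _; apply: low => //; rewrite ltnS.
  rewrite ler_pdivlMl ?ltr0n ?(ltnW M2) //; apply: le_trans low.
  have : (scale k (Y y) s)%:R <= 2 * ((scale k (Y y) s).-1)%:R :> R.
    by rewrite -natrM ler_nat; case: (scale _ _ _) M2 => [|[|m]] //= _; lia.
  move: (_%:R) (_.-1%:R) => a b ab.
  rewrite mulrCA mulrC ler_wpM2r ?exprn_ge0 ?invr_ge0 ?mulr_ge0 //; lra.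
have yR : 1 <= y%:R :> R by rewrite ler1n.
have lyR : l%:R <= y%:R :> R by rewrite ler_nat.
have xyR : x0%:R <= y%:R :> R by rewrite ler_nat.
have k0R : 0 < k%:R :> R by rewrite ltr0n.
have := le_trans lowT upT; apply/negP; rewrite -ltNge.
apply: (@le_lt_trans _ _ (y%:R * (3 * k%:R))); first by rewrite ler_wpM2r // mulr_ge0.
rewrite exprVn -invfM ltr_pdivlMr ?mulr_gt0 ?exprn_gt0 ?mulr_gt0 //.
have -> : (S y)%:R = k%:R * (25 * y%:R ^+ 3) :> R by rewrite /S /C natrM natrM natrX.
have yx : x0%:R ^+ 2 <= y%:R ^+ 2 :> R by rewrite ler_sqr ?nnegrE.
have y3 : 0 < y%:R * k%:R :> R by rewrite mulr_gt0 // (lt_le_trans _ yR).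
have h1 := ler_wpM2l (ltW y3) yx.
have h2 : 0 < y%:R * k%:R * y%:R ^+ 2 :> R by rewrite mulr_gt0 // exprn_gt0 // (lt_le_trans _ yR).
have -> : y%:R * (3 * k%:R) * ((2 * x0%:R) ^+ 2 * 2) = 24 * (y%:R * k%:R * x0%:R ^+ 2) :> R by ring.
have -> : k%:R * (25 * y%:R ^+ 3) = 25 * (y%:R * k%:R * y%:R ^+ 2) :> R by ring.
lra.
Qed.

End Step.

(** * Back to sets of integers *)

Section PositivePhases.
Local Open Scope complex_scope.
Variable R : realType.

(** Induction on the total mass in units of $1/(2x_0)$, initially at most $2lx_0$. A step that finds
    no $n$ removes at least one unit, and each step adds [B] exponentials to the bound. *)
Lemma positive_phases_recurrence (k : nat) : (0 < k)%N -> exists B : nat,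
  forall (x0 l : nat) (X : finType) (w : 'I_l -> X -> R) (p : 'I_l -> X -> {poly R}),
  (0 < x0)%N -> (forall i xi, 0 <= w i xi) -> (forall i, \sum_xi w i xi <= 1) ->
  (forall i xi, (size (p i xi) <= k.+1)%N) -> (forall i xi, (p i xi).[0] = 0) ->
  exists2 n, (0 < n <= iexp (B * (2 * l * x0)) (x0 + l))%N &
    forall i, - x0%:R^-1 <= cos_sum (w i) (p i) n.
Proof.
move=> k0; have [F [[B FB] step]] := increment_step R k0; exists B => x0 l X w p x00.
have x0R : 0 < x0%:R :> R by rewrite ltr0n.
move=> w0 w1; have : \sum_i \sum_xi w i xi <= (2 * l * x0)%:R * (2 * x0%:R)^-1.
  apply: (@le_trans _ _ (\sum_(i < l) 1)); first by apply: ler_sum => i _.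
  rewrite sumr_const card_ord -(mulr_natl 1) mulr1 mulnAC natrM natrM.
  by rewrite mulrAC divff ?mul1r // mulf_neq0 // gt_eqF.
elim: (2 * l * x0)%N w w0 w1 p => [|J IH] w w0 w1 p mass sp p0.
  exists 1%N; first by rewrite muln0 /= ltn_addr.
  move=> i; have w00 xi : w i xi = 0.
    apply: le_anti; rewrite w0 andbT; move: mass; rewrite mul0r; apply: le_trans.
    rewrite (bigD1 i) //= (bigD1 xi) //= -addrA lerDl addr_ge0 ?sumr_ge0 // => a _.
    by rewrite sumr_ge0.
  rewrite /cos_sum big1 => [|xi _]; first by rewrite oppr_le0 invr_ge0.
  by rewrite w00 mul0r.
set y := iexp (B * J) (x0 + l) in IH *.
have yE : (iexp B y = iexp (B * J.+1) (x0 + l))%N by rewrite mulnS iexpD.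
have xly : (x0 + l <= y)%N by exact: iexp_ge.
have x0y : (0 < x0 <= y)%N by rewrite x00 (leq_trans (leq_addr _ _) xly).
have yy : (0 < y <= y)%N by rewrite leqnn andbT (leq_trans x00) //; case/andP: x0y.
have ly : (l <= y)%N by rewrite (leq_trans (leq_addl _ _) xly).
(* Taking $H=y$ covers every multiplier that the induction hypothesis can return for the reduced
   weights. *)
have [[n /andP[n0 nF] hn]|] := step y x0 y l X w p x0y yy ly w0 w1 sp p0.
  by exists n => //; rewrite n0 -yE (leq_trans nF).
move=> [q [U [q0 qF [i0 heavy] pos]]].
pose w' i xi := if U i xi then 0 else w i xi.
pose p' i xi := p i xi \Po (q%:R *: 'X + 0%:P).
have w'0 i xi : 0 <= w' i xi by rewrite /w'; case: ifP.
have split_w i : \sum_xi w i xi = \sum_(xi | U i xi) w i xi + \sum_xi w' i xi.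
  rewrite (bigID (U i)) /=; congr (_ + _); rewrite big_mkcond.
  by apply: eq_bigr => xi _; rewrite /w'; case: (U i xi).
have w'1 i : \sum_xi w' i xi <= 1.
  by apply: le_trans (w1 i); rewrite split_w lerDr sumr_ge0.
have mass' : \sum_i \sum_xi w' i xi <= J%:R * (2 * x0%:R)^-1.
  have : \sum_i \sum_xi w i xi = \sum_i \sum_(xi | U i xi) w i xi + \sum_i \sum_xi w' i xi.
    by rewrite -big_split; apply: eq_bigr => i _; exact: split_w.
  have : \sum_(xi | U i0 xi) w i0 xi <= \sum_i \sum_(xi | U i xi) w i xi.
    by rewrite [leRHS](bigD1 i0) //= lerDl sumr_ge0 // => i _; rewrite sumr_ge0.
  by move: mass; rewrite -natr1 mulrDl mul1r; lra.
have sp' i xi : (size (p' i xi) <= k.+1)%N by exact: size_comp_affine.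
have p'0 i xi : (p' i xi).[0] = 0 by rewrite horner_comp !hornerE.
have [n /andP[n0 ny] hn] := IH w' w'0 w'1 p' mass' sp' p'0.
exists (q * n)%N.
  by rewrite muln_gt0 q0 n0 -yE (leq_trans _ (FB y)) // (leq_trans _ qF) // leq_mul.
move=> i; apply: le_trans (hn i) _; apply: ler_sum => xi _.
have -> : (p' i xi).[n%:R] = (p i xi).[(q * n)%:R] by rewrite horner_comp !hornerE natrM.
rewrite /w'; case: ifP => // Uxi; rewrite mul0r mulr_ge0 //.
by apply: pos => //; rewrite n0.
Qed.

End PositivePhases.

(** * Correlations modulo $N$ *)

Section CyclicCount.
Variables (N : nat) (A : {fset int}).
Hypothesis AN : subset_1N N A.

Definition cyclic_count (s : int) : nat :=
  (\sum_(a <- A) \sum_(b <- A) (N%:Z %| (a - b + s)%R)%Z)%N.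

Lemma dvdz_small (b c : int) : 1 <= b <= N%:Z -> 1 <= c <= N%:Z ->
  (N%:Z %| (c - b)%R)%Z = (b == c).
Proof.
move=> hb hc; apply/idP/eqP => [/dvdzP[m e]|->]; last by rewrite subrr dvdz0.
have : m = 0 by nia.
by move=> m0; move: e; rewrite m0; lia.
Qed.

Lemma sum_dvdz_le1 (c : int) : (\sum_(b <- A) (N%:Z %| (c - b)%R)%Z <= 1)%N.
Proof.
have := fset_uniq A; have : {subset enum_fset A <= enum_fset A} by [].
move: {1 3 4}(enum_fset A) => s; elim: s => [|b s IH] sub; first by rewrite big_nil.
rewrite /= => /andP[bs us]; rewrite big_cons.
have subs : {subset s <= enum_fset A} by move=> a as_; apply: sub; rewrite inE as_ orbT.
have [hb|hb] := boolP (N%:Z %| (c - b)%R)%Z; last by rewrite add0n IH.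
rewrite big_seq big1 // => a as_; apply/eqP; rewrite eqb0; apply/negP => ha.
have : (N%:Z %| (a - b)%R)%Z.
  have -> : a - b = (c - b) - (c - a) by ring.
  exact: rpredB.
rewrite dvdz_small ?AN ?sub ?inE ?eqxx ?as_ ?orbT // => /eqP ba.
by rewrite -ba in as_; rewrite as_ in bs.
Qed.

Lemma cyclic_count0 : cyclic_count 0 = #|` A|.
Proof.
rewrite /cyclic_count; transitivity (\sum_(a <- A) 1)%N; last first.
  by rewrite sum1_size.
rewrite big_seq [RHS]big_seq; apply: eq_bigr => a aA.
apply/eqP; rewrite eqn_leq; apply/andP; split.
  by under eq_bigr do rewrite addr0; exact: sum_dvdz_le1.
by rewrite (big_rem a) //= subrr addr0 dvdz0.
Qed.

(** Each $a$ has at most one partner $b\equiv a+s$. It is $a+s$ itself unless $a+s$ leaves $[1,N]$,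
    which happens only for the at most $|s|$ elements near one end. *)
Lemma cyclic_count_le s :
  (cyclic_count s <= #|` (A `&` translate A s)%fset| + `|s|)%N.
Proof.
pose inA (a : int) := a + s \in A.
pose out (a : int) := ~~ (1 <= a + s <= N%:Z).
have pt a : a \in A -> (\sum_(b <- A) (N%:Z %| (a - b + s)%R)%Z <= inA a + out a)%N.
  move=> aA; have e b : (N%:Z %| (a - b + s)%R)%Z = (N%:Z %| (a + s - b)%R)%Z.
    by congr (_ %| _)%Z; ring.
  under eq_bigr do rewrite e.
  rewrite /out; case: (boolP (1 <= a + s <= N%:Z)) => hs; last first.
    by apply: leq_trans (sum_dvdz_le1 _) _; rewrite addn1.
  have [as_|nas] := boolP (inA a); first exact: sum_dvdz_le1.
  rewrite big_seq big1 // => b bA; apply/eqP; rewrite eqb0; apply/negP.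
  by rewrite (dvdz_small (AN bA) hs) => /eqP bE; move: nas; rewrite /inA -bE bA.
apply: (@leq_trans (\sum_(a <- A) (inA a + out a))).
  by rewrite /cyclic_count big_seq [leqRHS]big_seq; apply: leq_sum => a; exact: pt.
have cnt (P : pred int) : (\sum_(a <- A) P a)%N = size (seq.filter P (enum_fset A)).
  by rewrite size_filter -sum1_count [RHS]big_mkcond /=; apply: eq_bigr => a _; case: (P a).
rewrite big_split /= !cnt; apply: leq_add.
  rewrite -(size_map (fun a => a + s)); apply: uniq_leq_size.
    by rewrite map_inj_uniq ?filter_uniq ?fset_uniq // => a b /addIr.
  move=> c /mapP[a]; rewrite mem_filter => /andP[as_ aA] ->.
  by rewrite in_fsetI; apply/andP; split; [exact: as_ | apply/imfsetP; exists a].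
pose lst := if 0 <= s then [seq N%:Z - i%:Z | i <- iota 0 `|s|]
  else [seq 1 + i%:Z | i <- iota 0 `|s|].
have <- : size lst = `|s|%N by rewrite /lst; case: ifP; rewrite size_map size_iota.
apply: uniq_leq_size; first by rewrite filter_uniq ?fset_uniq.
move=> a; rewrite mem_filter => /andP[outa /AN /andP[a1 aN]]; move: outa; rewrite /out.
rewrite negb_and -!ltNge => outa; rewrite /lst; case: ifP => s0; apply/mapP.
  by exists `|N%:Z - a|%N; rewrite ?mem_iota; lia.
by exists `|a - 1|%N; rewrite ?mem_iota; lia.
Qed.

End CyclicCount.

(** * Fourier expansion on $\mathbb Z/N\mathbb Z$ *)

Section Fourier.
Local Open Scope complex_scope.
Variable R : realType.

(** A geometric sum with ratio $z$, $z^N=1$, vanishes unless $z=1$; by [near_int_cnorm] the latter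
    forces $t/N$ to be an integer. *)
Lemma sum_expi_divisible (N : nat) (t : int) : (0 < N)%N ->
  \sum_(xi < N) expi (xi%:R * (t%:~R / N%:R) : R) = if (N%:Z %| t)%Z then N%:R else 0.
Proof.
move=> N0; have NR : N%:R != 0 :> R by rewrite pnatr_eq0 -lt0n.
under eq_bigr do rewrite expiMn.
set z := expi _; have zN : z ^+ N = 1.
  by rewrite -expiMn mulrCA divff // mulr1 expi_int.
have -> : (N%:Z %| t)%Z = (z == 1).
  apply/dvdzP/eqP => [[m e]|z1].
    by rewrite /z e intrM mulfK // expi_int.
  have [m] := near_int_cnorm (t%:~R / N%:R : R); rewrite -/z z1 subrr cnorm0.
  rewrite normr_le0 subr_eq0 => /eqP e; exists m.
  have : (t%:~R : R) = (m * N%:Z)%:~R by rewrite intrM -e mulfVK.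
  by move/(@intr_inj R).
case: eqP => [->|z1].
  by under eq_bigr do rewrite expr1n; rewrite sumr_const card_ord.
apply/eqP; have := subrX1 z N; rewrite zN subrr => /esym/eqP.
by rewrite mulf_eq0 subr_eq0 => /orP[/eqP//|].
Qed.

Section Coefficients.
Variables (N : nat) (A : {fset int}).
Hypothesis N0 : (0 < N)%N.
Hypothesis AN : subset_1N N A.

(** The transform is normalised by $1/N$, which makes the total mass $|A|/N$. *)
Definition fourier_weight (xi : 'I_N) : R :=
  cnorm (\sum_(a <- A) expi (xi%:R * (a%:~R / N%:R))) ^+ 2 / N%:R ^+ 2.

Let NR : N%:R != 0 :> R. Proof. by rewrite pnatr_eq0 -lt0n. Qed.

Lemma fourier_weight_ge0 xi : 0 <= fourier_weight xi.
Proof. by rewrite divr_ge0 // sqr_ge0. Qed.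

Lemma fourier_weight_sum s :
  \sum_xi fourier_weight xi * complex.Re (expi (xi%:R * (s%:~R / N%:R))) =
  (cyclic_count N A s)%:R / N%:R.
Proof.
have key : \sum_xi (fourier_weight xi)%:C * expi (xi%:R * (s%:~R / N%:R)) =
    ((cyclic_count N A s)%:R / N%:R)%:C.
  pose T (xi : 'I_N) (a b : int) : R[i] := expi (xi%:R * ((a - b + s)%:~R / N%:R)).
  have -> : \sum_(xi < N) (fourier_weight xi)%:C * expi (xi%:R * (s%:~R / N%:R)) =
      (N%:R ^- 2)%:C * \sum_(xi < N) \sum_(a <- A) \sum_(b <- A) T xi a b.
    rewrite mulr_sumr; apply: eq_bigr => xi _.
    pose z : R[i] := \sum_(a <- A) expi (xi%:R * (a%:~R / N%:R)).
    have -> : (fourier_weight xi)%:C = z * conjc z * (N%:R ^- 2)%:C.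
      by rewrite -cnorm_sqr_conj -[RHS](rmorphM (real_complex R)).
    rewrite mulrAC [RHS]mulrC; congr (_ * _); rewrite /z.
    rewrite conjc_sum !mulr_suml; apply: eq_bigr => a _.
    rewrite mulr_sumr mulr_suml; apply: eq_bigr => b _.
    rewrite conjc_expi -!expiD; congr expi.
    by rewrite intrD intrB; ring.
  rewrite exchange_big /=; under eq_bigr do rewrite exchange_big /=.
  have -> : \sum_(a <- A) \sum_(b <- A) \sum_(xi < N) T xi a b = (N%:R * (cyclic_count N A s)%:R)%:C.
    rewrite /cyclic_count rmorphM !rmorph_nat natr_sum mulr_sumr; apply: eq_bigr => a _.
    rewrite natr_sum mulr_sumr; apply: eq_bigr => b _.
    by rewrite /T sum_expi_divisible //; case: ifP; rewrite ?mulr1 ?mulr0.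
  by rewrite -rmorphM; congr (_%:C); field.
rewrite -[RHS]/(complex.Re ((cyclic_count N A s)%:R / N%:R)%:C) -key raddf_sum.
by apply: eq_bigr => xi _; rewrite /= mul0r subr0.
Qed.

Lemma fourier_weight0 : fourier_weight (Ordinal N0) = (#|` A|%:R / N%:R) ^+ 2.
Proof.
rewrite /fourier_weight; under eq_bigr do rewrite mul0r expi0.
by rewrite big_const_seq count_predT iter_addr_0 cnorm_nat expr_div_n.
Qed.

Lemma fourier_weight_le1 : \sum_xi fourier_weight xi <= 1.
Proof.
have := fourier_weight_sum 0; rewrite (cyclic_count0 AN).
have -> : \sum_xi fourier_weight xi * complex.Re (expi (xi%:R * (0%:~R / N%:R))) =
    \sum_xi fourier_weight xi.
  by apply: eq_bigr => xi _; rewrite mul0r mulr0 expi0 mulr1.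
move=> ->; rewrite ler_pdivrMr ?ltr0n // mul1r ler_nat.
have sub : {subset enum_fset A <= [seq i%:Z + 1 | i <- iota 0 N]}.
  move=> a /AN /andP[a1 aN]; apply/mapP; exists `|a - 1|%N; last by lia.
  by rewrite mem_iota; lia.
by have := uniq_leq_size (fset_uniq A) sub; rewrite size_map size_iota.
Qed.

End Coefficients.
End Fourier.

Lemma towerE j : tower j = iexp j 0.
Proof. by elim: j => //= j ->. Qed.

(** Since $z\le T(z)$, the starting value of an iterated exponential can be traded for that many
    further levels. *)
Lemma iexp_le_tower a z : (iexp a z <= tower (a + z))%N.
Proof.
rewrite towerE iexpD; apply: iexp_homo; rewrite -towerE.
by elim: z => //= z IH; apply: leq_ltn_trans IH _; apply: ltn_expl.
Qed.

Lemma leq_tower i j : (i <= j)%N -> (tower i <= tower j)%N.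
Proof.
move=> ij; rewrite -(subnKC ij) [in leqRHS]addnC !towerE iexpD; exact: iexp_ge.
Qed.

Lemma tower_real_ge (R : realType) (h : R) j : j%:R <= h -> (tower j <= tower_real h)%N.
Proof.
move=> jh; apply: leq_tower; rewrite -lez_nat gez0_abs.
  by rewrite -(ler_int R); apply: le_trans jh (Num.Theory.ceil_ge _).
by rewrite -(ler_int R); apply: le_trans (ler0n R j) (le_trans jh (Num.Theory.ceil_ge _)).
Qed.

Lemma horner_int_bound (p : {poly int}) : exists c : nat,
  forall k n : nat, (size p <= k.+1)%N -> (0 < n)%N -> (`|p.[n%:Z]| <= c * n ^ k)%N.
Proof.
exists (\sum_(j < size p) `|(p`_j)%R|)%N => k n sp n0.
rewrite -lez_nat abszE horner_coef; apply: le_trans (ler_norm_sum _ _ _) _.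
rewrite PoszM (big_morph Posz PoszD (erefl _)) mulr_suml.
apply: ler_sum => j _; rewrite normrM -abszE ler_wpM2l //.
rewrite normrX ger0_norm // -!natz -natrX ler_nat.
by rewrite leq_pexp2l // -ltnS (leq_trans (ltn_ord j)).
Qed.

Section Threshold.
Variable R : realType.

(** Frequency 0 gives $(|A|/N)^2$, the others at least $-1/x_0$; for these $N$ the wrap-around
    $|P_i(n)|/N$ is at most $1/x_0$. The total loss $2/x_0$ is below $\varepsilon$. *)
Lemma popular_difference_threshold (k : nat) : (0 < k)%N -> exists B : nat,
  forall (l : nat) (P : 'I_l -> {poly int}), poly_family k P ->
  exists c : nat, (0 < c)%N /\ forall (x0 : nat) (eps : R), (0 < x0)%N -> 2 < x0%:R * eps ->
    admissible_threshold P eps (c * (x0 * iexp (B * (2 * l * x0)) (x0 + l) ^ k)).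
Proof.
move=> k0; have [B core] := positive_phases_recurrence R k0; exists B => l P famP.
have /choice [cs csP] := fun i => horner_int_bound (P i).
exists (\sum_i cs i).+1; split => // x0 eps x00 xeps N A N0 Nbig AN.
set M := iexp _ _ in Nbig.
have NR : 0 < N%:R :> R by rewrite ltr0n.
pose w (i : 'I_l) (xi : 'I_N) : R := if xi == Ordinal N0 then 0 else fourier_weight R A xi.
pose p (i : 'I_l) (xi : 'I_N) : {poly R} := (xi%:R / N%:R) *: map_poly intr (P i).
have w0 i xi : 0 <= w i xi by rewrite /w; case: ifP => // _; exact: fourier_weight_ge0.
have w1 i : \sum_xi w i xi <= 1.
  apply: le_trans (fourier_weight_le1 R N0 AN); apply: ler_sum => xi _.
  by rewrite /w; case: ifP => // _; exact: fourier_weight_ge0.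
have pE i xi (n : nat) : (p i xi).[n%:R] = xi%:R * ((P i).[n%:Z]%:~R / N%:R).
  by rewrite hornerZ -[n%:R]/(n%:Z%:~R) horner_map; ring.
have sp i xi : (size (p i xi) <= k.+1)%N.
  by rewrite (leq_trans (size_scale_leq _ _)) // (leq_trans (size_poly _ _)) // (famP i).2.
have p0 i xi : (p i xi).[0] = 0.
  by rewrite -[0]/(0%:R) pE (famP i).1 mul0r mulr0.
have [n /andP[n0 nM] hn] := core x0 l _ w p x00 w0 w1 sp p0.
exists n; split => // i; set s := (P i).[n%:Z].
have x0R : 0 < x0%:R :> R by rewrite ltr0n.
have sN : x0%:R * `|s|%N%:R <= N%:R :> R.
  rewrite -natrM ler_nat; apply: leq_trans Nbig.
  rewrite mulnCA leq_mul2l; apply/orP; right.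
  apply: leq_trans (csP i k n _ n0) _; first by rewrite (famP i).2.
  apply: leq_mul; first by rewrite leqW // (bigD1 i) //= leq_addr.
  by rewrite leq_exp2r.
have e0 : expi ((Ordinal N0 : 'I_N)%:R * (s%:~R / N%:R)) = 1 :> R[i] by rewrite mul0r expi0.
have := fourier_weight_sum R A N0 s; rewrite (bigD1 (Ordinal N0)) // e0 mulr1 fourier_weight0.
have -> : \sum_(xi < N | xi != Ordinal N0) fourier_weight R A xi *
    complex.Re (expi (xi%:R * (s%:~R / N%:R))) = cos_sum (w i) (p i) n.
  rewrite /cos_sum [RHS](bigD1 (Ordinal N0)) //= {1}/w eqxx mul0r add0r.
  by apply: eq_bigr => xi xi0; rewrite pE /w (negPf xi0).
have := hn i; have := cyclic_count_le AN s.
move: (cyclic_count _ _ _) => cc; rewrite -(ler_nat R) natrD => ccs hn' e.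
set inter := #|` (A `&` _)%fset|%:R in ccs *.
have e1 : cc%:R / N%:R <= inter / N%:R + x0%:R^-1.
  rewrite ler_pdivrMr // mulrDl divfK ?gt_eqF // (le_trans ccs) // lerD2l.
  by rewrite ler_pdivlMl.
have xe : x0%:R^-1 < eps / 2 by rewrite ltr_pdivlMr // mulrC ltr_pdivrMr // mulrC.
rewrite [LHS]/= in e; move: hn' e e1 xe; lra.
Qed.

End Threshold.

Theorem theorem1p6 (R : realType) :
  (forall (k l : nat) (P : 'I_l -> {poly int}),
     (1 <= k)%N -> (1 <= l)%N -> poly_family k P ->
     forall eps : R, 0 < eps ->
     exists N1 : nat, admissible_threshold P eps N1)
  /\
  (exists (C : R) (Cstar : nat -> nat -> R),
     0 < C /\ (forall k l : nat, 0 <= Cstar k l) /\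
     forall (k l : nat) (P : 'I_l -> {poly int}),
       (1 <= k)%N -> (1 <= l)%N -> poly_family k P ->
       exists c : nat, (0 < c)%N /\
       forall eps : R, 0 < eps ->
         admissible_threshold P eps
           (c * tower_real (Cstar k l + C * eps ^- 2)%R)%N).
Proof.
suff main : exists (C : R) (Cstar : nat -> nat -> R),
     0 < C /\ (forall k l : nat, 0 <= Cstar k l) /\
     forall (k l : nat) (P : 'I_l -> {poly int}),
       (1 <= k)%N -> (1 <= l)%N -> poly_family k P ->
       exists c : nat, (0 < c)%N /\
       forall eps : R, 0 < eps ->
         admissible_threshold P eps
           (c * tower_real (Cstar k l + C * eps ^- 2)%R)%N.
  split => //; have [C [Cstar [_ [_ H]]]] := main => k l P k1 l1 famP eps eps0.
  by have [c [_ hc]] := H k l P k1 l1 famP; eexists; exact: hc eps0.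
have /choice [B hB] : forall k, exists B : nat, (0 < k)%N ->
  forall (l : nat) (P : 'I_l -> {poly int}), poly_family k P ->
  exists c : nat, (0 < c)%N /\ forall (x0 : nat) (eps : R), (0 < x0)%N -> 2 < x0%:R * eps ->
    admissible_threshold P eps (c * (x0 * iexp (B * (2 * l * x0)) (x0 + l) ^ k)).
  case=> [|k]; first by exists 0%N.
  by have [B hB] := popular_difference_threshold R (ltn0Sn k); exists B.
(* The polynomial factor $z\cdot z^k$ is absorbed by [E] further exponentials, with [E] depending
   only on $k$. *)
have /choice [E hE] : forall k, exists E : nat, forall z, (z * z ^ k <= iexp E z)%N.
  move=> k; have [E hE] : elem (fun z => z * z ^ k)%N by auto with elem.
  by exists E.
(* The height is $a x_0+E+l$ with $x_0\le 2\varepsilon^{-1}+1$. By $2a\varepsilon^{-1}\le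
   a^2+\varepsilon^{-2}$ the factor $a$ moves into [Cstar], so $C=1$ works. *)
pose a k l : R := (2 * B k * l + 1)%:R.
exists 1, (fun k l => a k l ^+ 2 + a k l + (E k + l)%:R).
split => //; split; first by move=> k l; rewrite !addr_ge0 // sqr_ge0.
move=> k l P k1 l1 famP; have [c [c0 hc]] := hB k k1 l P famP.
exists c; split => // eps eps0.
pose x0 := (Num.truncn (2 / eps)).+1.
have d0 : 0 <= 2 / eps by rewrite divr_ge0 // ltW.
have /andP[x1 x2] := truncn_itv d0.
have xeps : 2 < x0%:R * eps by rewrite -ltr_pdivrMr.
have big := hc x0 eps (ltn0Sn _) xeps.
move=> N A N0 Nbig AN; apply: big => //; apply: leq_trans Nbig.
rewrite leq_mul2l; apply/orP; right.
set z := iexp _ _.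
have x0z : (x0 <= z)%N by apply: leq_trans (iexp_ge _ _); exact: leq_addr.
apply: (@leq_trans (z * z ^ k)); first by rewrite leq_mul2r x0z orbT.
apply: leq_trans (hE k z) _; rewrite /z -iexpD.
apply: leq_trans (iexp_le_tower _ _) _; apply: tower_real_ge.
rewrite mul1r -exprVn; set u := eps^-1.
have u0 : 0 <= u by rewrite invr_ge0 ltW.
have xu : x0%:R <= 2 * u + 1 :> R by rewrite /x0 -natr1 lerD2r.
have -> : (E k + B k * (2 * l * x0) + (x0 + l))%:R = a k l * x0%:R + (E k + l)%:R :> R.
  by rewrite /a -natrM -natrD; congr (_%:R); ring.
have a0 : 0 <= a k l by [].
have := ler_wpM2l a0 xu; have := sqr_ge0 (a k l - u).
have -> : (a k l - u) ^+ 2 = a k l ^+ 2 - 2 * (a k l * u) + u ^+ 2 by ring.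
lra.
Qed.
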